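(* Let $M$ be a $7$-manifold and let $(\varphi,\bar X,\lambda)$ be a closed Laplacian soliton on $M$ with $\lambda\neq 0$. Let $\tau$ be the torsion form of $\varphi$. Then $$\tfrac13|\tau|^2+d^*\bar X=\tfrac73\lambda\qquad\text{and}\qquad d^*(\bar X\lrcorner\varphi)=0 .$$
   Context: A $G_2$-structure on a $7$-manifold $M$ is given by a positive $3$-form $\varphi$, i.e. a smooth $3$-form which at each point is identified, by some linear isomorphism $T_pM\cong\mathbb{R}^7$, with $\varphi_0 = dx^{123} - dx^{167} - dx^{527} - dx^{563} + dx^{415} + dx^{426} + dx^{437}$. It determines a Riemannian metric $g_\varphi$ and an orientation (so that for $\varphi_0$ they are the standard ones on $\mathbb{R}^7$), hence a volume form $\mathrm{vol}$, Hodge star $*$, codifferential $d^*$ (formal adjoint of $d$) and $\psi=*\varphi$. Pointwise norms of forms satisfy $\alpha\wedge *\alpha=|\alpha|^2\mathrm{vol}$. Vector fields and $1$-forms are identified by the metric, so $d^*\bar X=-\mathrm{div}\,\bar X$. The $2$-forms split orthogonally as $\Lambda^2=\Lambda^2_7\oplus\Lambda^2_{14}$, where $\Lambda^2_7=\{\beta: *(\varphi\wedge\beta)=2\beta\}$ and $\Lambda^2_{14}=\{\beta: *(\varphi\wedge\beta)=-\beta\}$. If $d\varphi=0$ (a closed $G_2$-structure), the torsion form is the unique $\tau\in\Omega^2_{14}(M)$ with $d\psi=\tau\wedge\varphi=-*\tau$; equivalently $\tau=d^*\varphi$. A closed Laplacian soliton is a triple $(\varphi,\bar X,\lambda)$ of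 a closed $G_2$-structure $\varphi$, a smooth vector field $\bar X$ and a constant $\lambda\in\mathbb{R}$ with $\Delta\varphi=\lambda\varphi+L_{\bar X}\varphi$, where $\Delta=dd^*+d^*d$ is the Hodge Laplacian of $g_\varphi$ and $L$ is the Lie derivative. *)

(* Defs.v *)
From mathcomp Require Import all_boot all_order all_algebra all_fingroup.
From mathcomp Require Import all_classical all_reals.
From mathcomp Require Import topology normedtype derive.

Set Implicit Arguments.
Unset Strict Implicit.
Unset Printing Implicit Defensive.

Import Order.TTheory GRing.Theory Num.Theory.
Import numFieldNormedType.Exports.
Local Open Scope classical_set_scope.
Local Open Scope ring_scope.

Section Smooth.
Variables (R : realType) (n : nat) (W : normedModType R).

(* U is meant to be open. *)
Fixpoint class_C (m : nat) (U : set 'rV[R]_n) (f : 'rV[R]_n -> W) : Prop :=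
  match m with
  | 0 => forall x, U x -> {for x, continuous f}
  | m'.+1 => (forall x, U x -> differentiable f x) /\
             forall v : 'rV[R]_n, class_C m' U (fun x => 'D_v f x)
  end.

Definition smooth_on (U : set 'rV[R]_n) (f : 'rV[R]_n -> W) : Prop :=
  forall m, class_C m U f.

End Smooth.

(* A smooth n-manifold without boundary, given by a smooth atlas.  A chart a
   is the homeomorphism [chart_map a] from the open set [chart_dom a] onto the
   open set [chart_img a] of R^n, with inverse [chart_inv a]; the values of
   these two maps elsewhere are irrelevant. *)
Record manifold (R : realType) (n : nat) := Manifold {
  carrier :> topologicalType;
  chart : Type;
  chart_dom : chart -> set carrier;
  chart_img : chart -> set 'rV[R]_n;
  chart_map : chart -> carrier -> 'rV[R]_n;
  chart_inv : chart -> 'rV[R]_n -> carrier;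
  manifold_hausdorff : hausdorff_space carrier;
  manifold_second_countable : @second_countable carrier;
  chart_dom_open : forall a, open (chart_dom a);
  chart_img_open : forall a, open (chart_img a);
  chart_dom_cover : forall p, exists a, chart_dom a p;
  chart_map_img : forall a p, chart_dom a p -> chart_img a (chart_map a p);
  chart_inv_dom : forall a x, chart_img a x -> chart_dom a (chart_inv a x);
  chart_mapK : forall a p, chart_dom a p -> chart_inv a (chart_map a p) = p;
  chart_invK : forall a x, chart_img a x -> chart_map a (chart_inv a x) = x;
  chart_map_continuous : forall a p, chart_dom a p ->
    {for p, continuous (chart_map a)};
  chart_inv_continuous : forall a x, chart_img a x ->
    {for x, continuous (chart_inv a)};
  transition_smooth : forall a b,
    smooth_on (chart_img a `&` chart_inv a @^-1` chart_dom b)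
              (chart_map b \o chart_inv a)
}.

Section LinearAlgebra.
Variables (R : realType) (n : nat).

(* Tangent vectors are row vectors, and k-tuples of vectors are the rows of a
   k x n matrix, so a k-form at a point is a function of such a matrix.  That
   it is multilinear and alternating is imposed by [alternating]. *)
Definition kform (k : nat) := 'M[R]_(k, n) -> R.

Definition set_row k (V : 'M[R]_(k, n)) (i : 'I_k) (u : 'rV[R]_n) :
  'M[R]_(k, n) := \matrix_(j < k) (if j == i then u else row j V).

Definition alternating k (w : kform k) : Prop :=
  (forall V i (c : R) (u v : 'rV[R]_n),
     w (set_row V i (c *: u + v)) =
       c * w (set_row V i u) + w (set_row V i v)) /\
  (forall V i j, i != j -> row i V = row j V -> w V = 0).

Definition pullback k (A : 'M[R]_n) (w : kform k) : kform k :=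
  fun V => w (V *m A).

(* Normalized so that dx^1 /\ ... /\ dx^k = det on R^k. *)
Definition wedge k l (a : kform k) (b : kform l) : kform (k + l) :=
  fun V => (k`!%:R * l`!%:R)^-1 *
    \sum_(s : 'S_(k + l))
       (-1) ^+ s * a (usubmx (row_perm s V)) * b (dsubmx (row_perm s V)).

Definition int_prod k (X : 'rV[R]_n) (w : kform k.+1) : kform k :=
  fun V => w (col_mx X V : 'M[R]_(1 + k, n)).

(* For a metric with Gram matrix g, the rows of [invmx g] are the basis
   reciprocal to the standard one.  Summing over all multi-indices and
   dividing by k! amounts to summing over increasing ones. *)
Definition form_inner (g : 'M[R]_n) k (a b : kform k) : R :=
  (k`!%:R)^-1 * \sum_(I : {ffun 'I_k -> 'I_n})
     a (rowsub I 1%:M) * b (rowsub I (invmx g)).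

(* The (n-k)-form *b with a /\ *b = (a, b)_g vol for all k-forms a:
   *b (V) = sum over increasing I of b(e_I) vol(e_I, V) in any oriented
   orthonormal basis e, rewritten in a basis and its reciprocal.  It is meant
   for k + l = n only; otherwise [conform_mx] returns its default 0. *)
Definition hodge_star (g : 'M[R]_n) (vol : kform n) k l (b : kform k) :
  kform l :=
  fun V => (k`!%:R)^-1 * \sum_(I : {ffun 'I_k -> 'I_n})
     b (rowsub I 1%:M) * vol (conform_mx 0 (col_mx (rowsub I (invmx g)) V)).

End LinearAlgebra.

Arguments hodge_star {R n} g vol {k} l b.

Section LocalCalculus.
Variables (R : realType) (n : nat).

Definition ext_d k (w : 'rV[R]_n -> kform R n k) : 'rV[R]_n -> kform R n k.+1 :=
  fun x V => \sum_(i < k.+1)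
    (-1) ^+ i * ('D_(row i V) (fun y => w y (row' i V) : R) x : R).

(* (L_X w)(v_1, ..., v_k) = X (w(v_1, ..., v_k)) - sum_i w(..., [X, v_i], ...)
   for constant fields v_i, for which [X, v_i] = - D_{v_i} X. *)
Definition lie k (X : 'rV[R]_n -> 'rV[R]_n) (w : 'rV[R]_n -> kform R n k) :
  'rV[R]_n -> kform R n k :=
  fun x V => 'D_(X x) (fun y => w y V : R) x +
    \sum_(i < k) w x (set_row V i ('D_(row i V) X x)).

End LocalCalculus.

Section G2Algebra.
Variable R : realType.

Definition dx (a b c : nat) : kform R 7 3 :=
  fun V => \det (colsub (fun j : 'I_3 => inord (nth 0%N [:: a; b; c] j).-1) V).

Definition phi0 : kform R 7 3 := fun V =>
  dx 1 2 3 V - dx 1 6 7 V - dx 5 2 7 V - dx 5 6 3 V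
  + dx 4 1 5 V + dx 4 2 6 V + dx 4 3 7 V.

(* A stands for the isomorphism v |-> v *m A from the tangent space to R^7. *)
Definition adapted (p : kform R 7 3) (A : 'M[R]_7) : Prop :=
  A \in unitmx /\ p =1 pullback A phi0.

Definition positive (p : kform R 7 3) : Prop := exists A, adapted p A.

(* The metric and the volume form are pulled back from R^7 along an adapted
   isomorphism; they do not depend on the one that [xget] selects, because
   the stabilizer G_2 of phi0 lies in SO(7). *)
Definition g2_frame (p : kform R 7 3) : 'M[R]_7 :=
  xget 1%:M [set A | adapted p A].

Definition g2_metric (p : kform R 7 3) : 'M[R]_7 :=
  g2_frame p *m (g2_frame p)^T.

Definition g2_vol (p : kform R 7 3) : kform R 7 7 :=
  pullback (g2_frame p) determinant.

Definition g2_star (p : kform R 7 3) k l (w : kform R 7 k) : kform R 7 l :=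
  hodge_star (g2_metric p) (g2_vol p) l w.

End G2Algebra.

Arguments g2_star {R} p {k} l w.

Section G2Calculus.
Variables (R : realType) (phi : 'rV[R]_7 -> kform R 7 3).

Definition star k l (w : 'rV[R]_7 -> kform R 7 k) : 'rV[R]_7 -> kform R 7 l :=
  fun x => g2_star (phi x) l (w x).

Arguments star {k} l w.

(* d^* = (-1)^p * d * on p-forms in dimension 7 (here p = k + 1). *)
Definition codiff k (w : 'rV[R]_7 -> kform R 7 k.+1) :
  'rV[R]_7 -> kform R 7 k :=
  fun x V => (-1) ^+ k.+1 * star k (ext_d (star (6 - k) w)) x V.

Definition laplacian k (w : 'rV[R]_7 -> kform R 7 k.+1) :
  'rV[R]_7 -> kform R 7 k.+1 :=
  fun x V => ext_d (codiff w) x V + codiff (ext_d w) x V.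

Definition flat (X : 'rV[R]_7 -> 'rV[R]_7) : 'rV[R]_7 -> kform R 7 1 :=
  fun x V => (X x *m g2_metric (phi x) *m V^T) 0 0.

Definition normsq k (w : 'rV[R]_7 -> kform R 7 k) : 'rV[R]_7 -> R :=
  fun x => form_inner (g2_metric (phi x)) (w x) (w x).

End G2Calculus.

Arguments star {R} phi {k} l w.

Section Fields.
Variables (R : realType) (n : nat) (M : manifold R n).

(* Fields on M are families of local representatives, one for each chart a,
   whose values matter on [chart_img a] only; representatives in two charts
   must be related by the Jacobian matrix of the transition map. *)
Definition form_field (k : nat) := chart M -> 'rV[R]_n -> kform R n k.
Definition vec_field := chart M -> 'rV[R]_n -> 'rV[R]_n.

Definition transition (a b : chart M) : 'rV[R]_n -> 'rV[R]_n :=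
  chart_map b \o chart_inv a.

Definition overlap (a b : chart M) : set 'rV[R]_n :=
  chart_img a `&` chart_inv a @^-1` chart_dom b.

Definition smooth_form k (w : form_field k) : Prop :=
  [/\ forall a x, chart_img a x -> alternating (w a x),
      forall a (V : 'M[R]_(k, n)),
        smooth_on (chart_img a) (fun x => w a x V : R) &
      forall a b x, overlap a b x ->
        w a x =1 pullback (jacobian (transition a b) x)
                          (w b (transition a b x))].

Definition smooth_vec_field (X : vec_field) : Prop :=
  (forall a, smooth_on (chart_img a) (X a)) /\
  (forall a b x, overlap a b x ->
     X b (transition a b x) = X a x *m jacobian (transition a b) x).

End Fields.

Section Solitons.
Variables (R : realType) (M : manifold R 7).

Definition G2_structure (phi : form_field M 3) : Prop :=
  smooth_form phi /\ forall a x, chart_img a x -> positive (phi a x).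

Definition closed_G2_structure (phi : form_field M 3) : Prop :=
  G2_structure phi /\
  forall a x, chart_img a x -> forall V, ext_d (phi a) x V = 0.

Definition psi (phi : form_field M 3) : form_field M 4 :=
  fun a => star (phi a) 4 (phi a).

Definition in_Lambda14 (phi : form_field M 3) (tau : form_field M 2) : Prop :=
  forall a x, chart_img a x -> forall V,
    g2_star (phi a x) 2 (wedge (phi a x) (tau a x)) V = - tau a x V.

Definition torsion_form (phi : form_field M 3) (tau : form_field M 2) : Prop :=
  [/\ smooth_form tau,
      in_Lambda14 phi tau,
      forall a x, chart_img a x -> forall V,
        ext_d (psi phi a) x V = wedge (tau a x) (phi a x) V &
      forall a x, chart_img a x -> forall V,
        ext_d (psi phi a) x V = - star (phi a) 5 (tau a) x V].

Definition closed_Laplacian_soliton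
    (phi : form_field M 3) (X : vec_field M) (lambda : R) : Prop :=
  [/\ closed_G2_structure phi,
      smooth_vec_field X &
      forall a x, chart_img a x -> forall V,
        laplacian (phi a) (phi a) x V =
          lambda * phi a x V + lie (X a) (phi a) x V].

End Solitons.

(* Main.v *)
(* At a point choose a basis in which phi is the model form phi_0.  Write
   sigma = X _| phi and omega = sigma - tau.  Since d^*phi = tau and d phi = 0,
   Cartan's formula turns the soliton equation into d omega = - lambda phi.

   As phi /\ sigma = 2 *sigma, phi /\ tau = d psi, d phi = 0 and d d psi = 0,
   2 d *sigma = d(phi /\ omega) = lambda phi /\ phi = 0, i.e. d^* sigma = 0.

   As sigma /\ psi = 3 *X and tau /\ psi = 0,
   3 d *X = d(omega /\ psi) = - lambda phi /\ psi + omega /\ d psi,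
   where phi /\ psi = 7 vol, d psi = - *tau, <sigma, tau> = 0; hence
   3 d *X = (- 7 lambda + |tau|^2) vol.

   Differentiating psi requires its smoothness.  The metric g and the determinant
   delta of an adapted frame satisfy 6 delta g(u, v) =
   ((u _| phi) /\ phi /\ (v _| phi)) (e_1, ..., e_7), a polynomial in phi, whose
   determinant 6^7 delta^9 has delta as a smooth ninth root. *)
Require Import Defs.
From mathcomp Require Import all_boot all_order all_algebra all_fingroup.
From mathcomp Require Import all_classical all_reals.
From mathcomp Require Import topology normedtype landau sequences derive exp.
From mathcomp Require Import interval_inference ring lra.

Set Implicit Arguments.
Unset Strict Implicit.
Unset Printing Implicit Defensive.

Import Order.TTheory GRing.Theory Num.Theory.
Import numFieldNormedType.Exports.
Local Open Scope classical_set_scope.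
Local Open Scope ring_scope.

(** * Smooth functions *)

(** [g2_frame] is chosen separately at each point, so nothing is known about how it varies. It
    serves for algebra at a fixed point, but anything to be differentiated must be expressed through
    quantities that [phi] determines. An odd root is convenient here: a real [delta] is determined
    by [delta ^+ 9] whatever its sign.

    The combination omega works because its two parts lie in different components of Lambda^2.
    Wedging with phi and with psi acts on sigma and tau by different constants, so a single 2-form
    whose derivative is known yields both identities.

    The algebraic identities are alternating in the arguments and linear in the contracted vector.
    They need testing only on an adapted frame, where phi and psi have integer components, and each
    then becomes a finite computation. The matrix formulas of the definitions are therefore first
    translated to forms on lists, for which such computations and the inductions of exterior
    calculus are direct. *)

Section NearEq.
Context {R : realType} {V W : normedModType R}.

Lemma differentiable_near0 (f : V -> W) x :
  (\forall y \near x, f y = 0) -> differentiable f x.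
Proof.
move=> f0.
have f0' : \forall h \near (0 : V), f (h + x) = 0.
  by move: f0; rewrite (near_shift 0) => f0; near do rewrite -[x in _ + x]subr0.
have fo : f \o shift x = cst (f x) + (\0 : {linear V -> W}) +o_ 0 id.
  apply/eqaddoP => _/posnumP[e]; near=> h.
  have -> : (f \o shift x - (cst (f x) + (\0 : {linear V -> W}))) h = 0.
    rewrite /= !fctE (nbhs_singleton f0) /= !addr0 subr0.
    by near: h.
  by rewrite normr0 mulr_ge0.
have c0 : continuous (\0 : {linear V -> W}) by move=> y; exact: cst_continuous.
by apply/diff_locallyP; rewrite (diff_unique c0 fo).
Unshelve. all: by end_near. Qed.

(** The difference [f - g] vanishes near [x], so only functions of that kind need a direct
    estimate. *)
Lemma near_eq_differentiable (f g : V -> W) x :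
  {near x, f =1 g} -> differentiable f x -> differentiable g x.
Proof.
move=> fg df; have -> : g = f - (f - g) by rewrite opprB addrC subrK.
apply: differentiableB => //; apply: differentiable_near0.
by near=> y; rewrite /= fctE; apply/eqP; rewrite subr_eq0; apply/eqP; near: y.
Unshelve. all: by end_near. Qed.

End NearEq.

Section ClassC.
Context {R : realType} {n : nat}.
Local Notation V := 'rV[R]_n.
Implicit Types (U : set V) (f g : V -> R) (m : nat).

Lemma class_C_ext (W : normedModType R) m U (f g : V -> W) : open U ->
  (forall x, U x -> f x = g x) -> class_C m U f -> class_C m U g.
Proof.
move=> oU; elim: m f g => [|m IH] f g fg /=; last first.
  have nfg x : U x -> {near x, f =1 g}.
    by move=> Ux; near=> y; apply: fg; near: y; exact: open_nbhs_nbhs.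
  move=> [df Df]; split=> [x Ux|v].
    exact: near_eq_differentiable (nfg x Ux) (df x Ux).
  by apply: IH (Df v) => x Ux; exact: near_eq_derive (nfg x Ux).
move=> cf x Ux; have nfg : {near x, f =1 g}.
  by near=> y; apply: fg; near: y; exact: open_nbhs_nbhs.
have := cf x Ux; rewrite /prop_for /continuous_at -(fg _ Ux) => cfx.
exact: cvg_trans (near_eq_cvg nfg) cfx.
Unshelve. all: by end_near. Qed.

Lemma class_C_continuous (W : normedModType R) m U (f : V -> W) :
  class_C m U f -> forall x, U x -> {for x, continuous f}.
Proof.
by case: m => [//|m] [df _] x Ux; exact: differentiable_continuous (df x Ux).
Qed.

Lemma class_C_leS (W : normedModType R) m U (f : V -> W) :
  class_C m.+1 U f -> class_C m U f.
Proof.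
elim: m f => [|m IH] f; first by move=> cf x; exact: (class_C_continuous cf).
by move=> [df Df]; split=> // v; exact: IH.
Qed.

Lemma class_C_cst m U (c : R) : class_C m U (fun=> c).
Proof.
elim: m c => [|m IH] c; first by move=> x _; exact: cst_continuous.
split=> [x _|v]; first exact: differentiable_cst.
have -> : (fun x => 'D_v (fun=> c) x) = (fun=> 0) :> (V -> R).
  by apply/funext => x; exact: derive_cst.
exact: IH.
Qed.

Lemma class_CD m U f g : open U ->
  class_C m U f -> class_C m U g -> class_C m U (fun x => f x + g x).
Proof.
move=> oU; elim: m f g => [|m IH] f g.
  by move=> cf cg x Ux; exact: cvgD (cf x Ux) (cg x Ux).
move=> [df Df] [dg Dg]; split=> [x Ux|v].
  by apply: (@differentiableD R V R f g); [exact: df|exact: dg].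
apply: (class_C_ext oU _ (IH _ _ (Df v) (Dg v))) => x Ux.
rewrite [RHS](_ : _ = 'D_v (f + g) x)//.
by rewrite deriveD//; apply: diff_derivable; [exact: df|exact: dg].
Qed.

Lemma class_CM m U f g : open U ->
  class_C m U f -> class_C m U g -> class_C m U (fun x => f x * g x).
Proof.
move=> oU; elim: m f g => [|m IH] f g cf0 cg0.
  by move=> x Ux; exact: cvgM (cf0 x Ux) (cg0 x Ux).
have [df Df] := cf0; have [dg Dg] := cg0; split=> [x Ux|v].
  by apply: (@differentiableM R V f g); [exact: df|exact: dg].
have cf := class_C_leS cf0; have cg := class_C_leS cg0.
apply: (class_C_ext oU _ (class_CD oU (IH _ _ cf (Dg v)) (IH _ _ cg (Df v)))).
move=> x Ux; rewrite [RHS](_ : _ = 'D_v (f * g) x)//.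
by rewrite deriveM//; apply: diff_derivable; [exact: df|exact: dg].
Qed.

Lemma class_CN m U f : open U -> class_C m U f -> class_C m U (fun x => - f x).
Proof.
move=> oU cf; apply: (class_C_ext oU _ (class_CM oU (class_C_cst m U (-1)) cf)).
by move=> x _; rewrite mulN1r.
Qed.

Lemma class_CV m U f : open U -> (forall x, U x -> f x != 0) ->
  class_C m U f -> class_C m U (fun x => (f x)^-1).
Proof.
move=> oU f0; elim: m => [|m IH] cf0.
  by move=> x Ux; exact: cvgV (f0 x Ux) (cf0 x Ux).
have [df Df] := cf0; have cf := IH (class_C_leS cf0); split=> [x Ux|v].
  by apply: (@differentiableV R V f); [exact: df|exact: f0].
apply: (class_C_ext oU _
  (class_CN oU (class_CM oU (class_CM oU cf cf) (Df v)))).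
move=> x Ux; rewrite deriveV ?f0//; first by rewrite expr2 invfM scaleNr.
exact/diff_derivable/df.
Qed.

Lemma class_C_sum m U (I : Type) (r : seq I) (P : pred I) (F : I -> V -> R) :
  open U -> (forall i, class_C m U (F i)) ->
  class_C m U (fun x => \sum_(i <- r | P i) F i x).
Proof.
move=> oU cF; elim: r => [|i r IH].
  by apply: (class_C_ext oU _ (class_C_cst m U 0)) => x _; rewrite big_nil.
case Pi : (P i).
  by apply: (class_C_ext oU _ (class_CD oU (cF i) IH)) => x _; rewrite big_cons Pi.
by apply: (class_C_ext oU _ IH) => x _; rewrite big_cons Pi.
Qed.

Lemma class_C_prod m U (I : Type) (r : seq I) (P : pred I) (F : I -> V -> R) :
  open U -> (forall i, class_C m U (F i)) ->
  class_C m U (fun x => \prod_(i <- r | P i) F i x).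
Proof.
move=> oU cF; elim: r => [|i r IH].
  by apply: (class_C_ext oU _ (class_C_cst m U 1)) => x _; rewrite big_nil.
case Pi : (P i).
  by apply: (class_C_ext oU _ (class_CM oU (cF i) IH)) => x _; rewrite big_cons Pi.
by apply: (class_C_ext oU _ IH) => x _; rewrite big_cons Pi.
Qed.

Lemma class_C_det m U k (A : V -> 'M[R]_k) : open U ->
  (forall i j, class_C m U (fun x => A x i j)) ->
  class_C m U (fun x => \det (A x)).
Proof.
move=> oU cA; apply: class_C_sum => // s; apply: class_CM => //.
  exact: class_C_cst.
exact: class_C_prod.
Qed.

Lemma class_C_invmx m U k (A : V -> 'M[R]_k) : open U ->
  (forall x, U x -> A x \in unitmx) ->
  (forall i j, class_C m U (fun x => A x i j)) ->
  forall i j, class_C m U (fun x => invmx (A x) i j).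
Proof.
move=> oU uA cA i j.
have d0 x : U x -> \det (A x) != 0.
  by move=> Ux; rewrite -unitfE -unitmxE uA.
have cV := class_CV oU d0 (class_C_det oU cA).
have cadj : class_C m U (fun x => (-1) ^+ (j + i) *
    \det (row' j (col' i (A x)))).
  apply: class_CM => //; first exact: class_C_cst.
  apply: class_C_det => // a b.
  by apply: (class_C_ext oU _ (cA (lift j a) (lift i b))) => x _; rewrite !mxE.
apply: (class_C_ext oU _ (class_CM oU cV cadj)) => x Ux.
by rewrite /invmx uA// !mxE.
Qed.

(** Bootstrapping: ['D_v f = f * 'D_v (f ^+ k) / (k * f ^+ k)] expresses the derivative through [f]
    itself, so each class reached by [f] gives the next one. Differentiability starts the
    process. *)
Lemma class_C_root m k U f : open U -> (0 < k)%N ->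
  (forall x, U x -> f x != 0) -> (forall x, U x -> differentiable f x) ->
  class_C m U (fun x => f x ^+ k) -> class_C m U f.
Proof.
move=> oU k0 f0 df; elim: m => [|m IH] cfk.
  by move=> x Ux; exact/differentiable_continuous/df.
split=> // v; have cf := IH (class_C_leS cfk); have [_ Dfk] := cfk.
have fk0 x : U x -> k%:R * f x ^+ k != 0.
  by move=> Ux; rewrite mulf_neq0 ?pnatr_eq0 -?lt0n// expf_neq0// f0.
have ck := class_CM oU (class_C_cst m U k%:R) (class_C_leS cfk).
apply: (class_C_ext oU _ (class_CM oU (class_CM oU cf (Dfk v)) (class_CV oU fk0 ck))).
move=> x Ux; have dx : derivable f x v by exact/diff_derivable/df.
rewrite (_ : (fun x => f x ^+ k) = f ^+ k); last first.
  by apply/funext => y; elim: (k) => [|j IHj] //; rewrite !exprS IHj.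
rewrite -(prednK k0) deriveX//= /GRing.scale /= exprS.
have fx := f0 x Ux; have d0 : k.-1.+1%:R != 0 :> R by rewrite pnatr_eq0.
have := expf_neq0 k.-1 fx.
move: (k.-1.+1%:R) d0 (f x ^+ k.-1) => c c0 d d0.
by field; rewrite c0 d0 fx.
Qed.

(** The root is taken without knowing the sign of [f]. With [h = f ^+ 9] the square [h * h] is
    positive near [x], and [expR (- (4 / 9) * ln (h * h))] equals [f ^- 8], so multiplying it by [h]
    recovers [f]. *)
Lemma differentiable_root9 f x : f x != 0 ->
  differentiable (fun y => f y ^+ 9) x ->
  (\forall y \near x, f y != 0) -> differentiable f x.
Proof.
move=> fx0 dh nf; pose h y := f y ^+ 9.
pose k y := h y * expR (- (4 / 9) * ln (h y * h y)).
apply: (@near_eq_differentiable R V R k).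
  near=> y; have fy0 : f y != 0 by near: y.
  have f2 : 0 < f y ^+ 2 by rewrite exprn_even_gt0.
  have l9 : ln (h y * h y) = ln (f y ^+ 2) * 9%:R.
    by rewrite /h -exprD (_ : (9 + 9 = 2 * 9)%N)// exprM lnXn// mulr_natr.
  rewrite /k l9 (_ : - (4 / 9) * _ = - (4%:R * ln (f y ^+ 2))); last by field.
  rewrite expRN expRM_natl lnK ?posrE// -exprM /h [X in X / _]exprS.
  by rewrite mulfK// expf_neq0.
have h0 : 0 < h x * h x by rewrite -expr2 exprn_even_gt0//= expf_neq0.
apply: (@differentiableM R V h (fun y => expR (- (4 / 9) * ln (h y * h y)))) => //.
apply: (@differentiable_comp R V R R (fun y => - (4 / 9) * ln (h y * h y)) expR).
  apply: (@differentiableM R V (fun=> - (4 / 9)) (fun y => ln (h y * h y))).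
    exact: differentiable_cst.
  refine (@differentiable_comp R V R R (fun y => h y * h y) (@ln R) x _ _).
    exact: (@differentiableM R V h h).
  by apply/derivable1_diffP; apply: ex_derive; exact: is_derive1_ln.
by apply/derivable1_diffP.
Unshelve. all: by end_near. Qed.

End ClassC.

(** * Symmetry of second derivatives *)

Section Schwarz.
Context {R : realType} {n : nat}.
Local Notation V := 'rV[R]_n.
Implicit Types (U : set V) (f : V -> R).

Lemma is_derive_line f (p u : V) (s : R) : differentiable f (p + s *: u) ->
  is_derive s 1 (fun t => f (p + t *: u)) ('D_u f (p + s *: u)).
Proof.
move=> df; have dfu : derivable f (p + s *: u) u := diff_derivable df.
have e : (fun h : R => h^-1 *: (((fun t => f (p + t *: u)) \o shift s) (h *: 1) -
    f (p + s *: u))) =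
  (fun h : R => h^-1 *: ((f \o shift (p + s *: u)) (h *: u) - f (p + s *: u))).
  by apply/funext => h; rewrite /= [h *: 1]mulr1 scalerDl [RHS]/= addrCA.
by split; rewrite /derivable /derive e.
Qed.

(** The mean value theorem is applied twice: along [u] to the difference of [f] between two parallel
    segments, then along [v] to ['D_u f]. *)
Lemma mixed_difference f (x u v : V) (h : R) : 0 < h ->
  (forall a b, 0 <= a <= h -> 0 <= b <= h ->
     differentiable f (x + a *: u + b *: v) /\
     differentiable (fun y => 'D_u f y) (x + a *: u + b *: v)) ->
  exists a b, [/\ 0 <= a <= h, 0 <= b <= h &
    f (x + h *: u + h *: v) - f (x + h *: u) - f (x + h *: v) + f x =
      h ^+ 2 * 'D_v (fun y => 'D_u f y) (x + a *: u + b *: v)].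
Proof.
move=> h0 df; have hh : 0 <= h <= h by rewrite ltW/=.
have h00 : 0 <= (0 : R) <= h by rewrite lexx ltW.
have dl b s : 0 <= b <= h -> 0 <= s <= h ->
    is_derive s 1 (fun t => f (x + b *: v + t *: u)) ('D_u f (x + b *: v + s *: u)).
  move=> bh sh; apply: is_derive_line.
  by rewrite addrAC; apply: (df _ _ sh bh).1.
pose F s := f (x + h *: v + s *: u) - f (x + 0 *: v + s *: u).
pose F' s := 'D_u f (x + h *: v + s *: u) - 'D_u f (x + 0 *: v + s *: u).
have dF s : 0 <= s <= h -> is_derive s 1 F (F' s).
  by move=> sh; apply: is_deriveB; exact: dl.
have [||a ah Fa] := MVT_segment (f := F) (df := F') (ltW h0).
- by move=> s; rewrite in_itv/= => /andP[s0 sh]; apply: dF; rewrite !ltW.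
- apply: derivable_within_continuous => s; rewrite in_itv/= => /dF[]//.
have {}ah : 0 <= a <= h by move: ah; rewrite in_itv.
pose G b := 'D_u f (x + a *: u + b *: v).
have dG b : 0 <= b <= h ->
    is_derive b 1 G ('D_v (fun y => 'D_u f y) (x + a *: u + b *: v)).
  by move=> bh; apply: (@is_derive_line (fun y => 'D_u f y)); apply: (df _ _ ah bh).2.
have [||b bh Gb] := MVT_segment (f := G)
  (df := fun b => 'D_v (fun y => 'D_u f y) (x + a *: u + b *: v)) (ltW h0).
- by move=> s; rewrite in_itv/= => /andP[s0 sh]; apply: dG; rewrite !ltW.
- apply: derivable_within_continuous => s; rewrite in_itv/= => /dG[]//.
have {}bh : 0 <= b <= h by move: bh; rewrite in_itv.
exists a, b; split => //.
have e1 : F h - F 0 = f (x + h *: u + h *: v) - f (x + h *: u) - f (x + h *: v) + f x.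
  by rewrite /F !scale0r !addr0 opprB addrA addrAC [x + h *: v + _]addrAC.
have e2 : F' a = G h - G 0.
  by rewrite /F' /G !scale0r !addr0 [x + h *: v + _]addrAC.
by rewrite -e1 Fa e2 Gb subr0 expr2 mulrC mulrA [h * _ * h]mulrAC mulrC mulrA.
Qed.

Lemma continuous_eq_near (g1 g2 : V -> R) (x : V) :
  {for x, continuous g1} -> {for x, continuous g2} ->
  (forall r : R, 0 < r -> exists y z,
     [/\ `|x - y| < r, `|x - z| < r & g1 y = g2 z]) ->
  g1 x = g2 x.
Proof.
move=> c1 c2 H; apply/eqP; apply: contraT => L12.
pose e := `|g1 x - g2 x| / 2.
have e0 : 0 < e by rewrite divr_gt0// normr_gt0 subr_eq0.
have {}c1 := (cvgrPdist_lt _ _).1 c1 e e0.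
have {}c2 := (cvgrPdist_lt _ _).1 c2 e e0.
have : nbhs x (fun t => `|g1 x - g1 t| < e /\ `|g2 x - g2 t| < e).
  by apply: filterI; [apply: c1|apply: c2].
rewrite -nbhs_nbhs_norm => -[r /= r0 xr].
have [y [z [xy xz yz]]] := H r r0.
have [P1 _] := xr _ xy; have [_ P2] := xr _ xz.
have : `|g1 x - g2 x| < e + e.
  rewrite (_ : g1 x - g2 x = (g1 x - g1 y) - (g2 x - g2 z)); last first.
    by rewrite -yz opprB addrA subrK.
  by apply: (le_lt_trans (ler_normB _ _)); rewrite ltrD.
by rewrite /e -splitr ltxx.
Qed.

(** The second difference over a small parallelogram is symmetric in [u] and [v], and each order of
    [mixed_difference] turns it into [h ^+ 2] times a mixed derivative at a nearby point. The two
    mixed derivatives thus share values arbitrarily close to [x], and continuity concludes. *)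
Lemma derive_comm f U (x u v : V) : open U -> U x -> class_C 2 U f ->
  'D_u (fun y => 'D_v f y) x = 'D_v (fun y => 'D_u f y) x.
Proof.
move=> oU Ux [df Df].
apply: (@continuous_eq_near (fun y => 'D_u (fun z => 'D_v f z) y)
                            (fun y => 'D_v (fun z => 'D_u f z) y)).
- exact: (Df v).2.
- exact: (Df u).2.
move=> r r0.
have : nbhs x U by exact: open_nbhs_nbhs.
rewrite -nbhs_nbhs_norm => -[r1 /= r10 xr].
pose N := `|u| + `|v| + 1.
have N0 : 0 < N by rewrite ltr_wpDl// addr_ge0.
have r20 : 0 < Num.min r r1 by rewrite lt_min r0.
(* The vector [a *: u + b *: v] has norm at most [h * N], half the allowed radius, so the
   parallelogram stays in [U] and near [x]. *)
pose h := Num.min r r1 / N / 2.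
have h0 : 0 < h by rewrite !divr_gt0.
have near_x a b : 0 <= a <= h -> 0 <= b <= h ->
    `|x - (x + a *: u + b *: v)| < Num.min r r1.
  move=> /andP[a0 ah] /andP[b0 bh].
  rewrite -addrA opprD addNKr normrN.
  apply: (le_lt_trans (ler_normD _ _)); rewrite !normrZ !ger0_norm//.
  apply: (@le_lt_trans _ _ (h * N)).
    have := ler_wpM2r (normr_ge0 u) ah; have := ler_wpM2r (normr_ge0 v) bh.
    by rewrite /N; move: (`|u|) (`|v|) => p q ? ?; nra.
  by rewrite /h mulrAC divfK ?gt_eqF//; lra.
have hD w a b : 0 <= a <= h -> 0 <= b <= h ->
     differentiable f (x + a *: u + b *: v) /\
     differentiable (fun y => 'D_w f y) (x + a *: u + b *: v).
  move=> ah bh; have := near_x a b ah bh; rewrite lt_min => /andP[_ /xr Uab].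
  by split; [exact: df|exact: (Df w).1].
have [a [b [ah bh E1]]] := mixed_difference h0 (hD u).
have [|c [d [ch dh E2]]] := @mixed_difference f x v u h h0.
  by move=> c d ch dh; rewrite addrAC; apply: hD.
exists (x + c *: v + d *: u), (x + a *: u + b *: v); split.
- by rewrite addrAC; have := near_x d c dh ch; rewrite lt_min => /andP[].
- by have := near_x a b ah bh; rewrite lt_min => /andP[].
apply: (@mulfI _ (h ^+ 2)); first by rewrite sqrf_eq0 gt_eqF.
refine (etrans (esym E2) (etrans _ E1)).
congr (_ + _); rewrite [LHS]addrAC; by congr (f _ - _ - _); rewrite addrAC.
Qed.

End Schwarz.

(** * Exterior forms as functions of lists of vectors *)

Definition contract {T K : Type} (v : T) (F : seq T -> K) : seq T -> K :=
  fun s => F (v :: s).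

(* Forms are functions of lists of vectors.  The wedge product and the exterior
   derivative are defined by recursion on the list, through their interaction
   with interior products; the Leibniz rule, d d = 0 and Cartan's formula then
   become inductions on the list.

   The product of a form [a] of degree [k] with a form [b], defined by the
   rule v _| (a /\ b) = (v _| a) /\ b + (-1)^k a /\ (v _| b). *)
Fixpoint lwedge {T : Type} {K : pzRingType} (k : nat) (a b : seq T -> K)
    (s : seq T) : K :=
  match k, s with
  | 0, _ => a [::] * b s
  | k'.+1, [::] => 0
  | k'.+1, v :: s' =>
      lwedge k' (contract v a) b s' + (-1) ^+ k * lwedge k a (contract v b) s'
  end.

Section ListForms.
Context {R : realType} {V : lmodType R}.
Implicit Types (F G a b : seq V -> R) (s t : seq V) (u v w : V) (k : nat).

(** [F] is a family of forms, one for each length of the list. Vanishing is required for adjacent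
    equal entries only; distant ones are brought together by [alt_move]. *)
Definition multilinear_alt F : Prop :=
  (forall s t (c : R) u v,
     F (s ++ (c *: u + v) :: t) = c * F (s ++ u :: t) + F (s ++ v :: t)) /\
  (forall s t u, F (s ++ u :: u :: t) = 0).

Lemma lwedge0 a b s : lwedge 0 a b s = a [::] * b s.
Proof. by case: s. Qed.

Lemma lwedgeS k a b v s : lwedge k.+1 a b (v :: s) =
  lwedge k (contract v a) b s + (-1) ^+ k.+1 * lwedge k.+1 a (contract v b) s.
Proof. by []. Qed.

Lemma contract_alt v F : multilinear_alt F -> multilinear_alt (contract v F).
Proof.
by move=> [lF aF]; split=> [s t c u w|s t u]; rewrite /contract -!cat_cons;
  [exact: lF|exact: aF].
Qed.

Lemma alt_linear F c u v t : multilinear_alt F ->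
  F ((c *: u + v) :: t) = c * F (u :: t) + F (v :: t).
Proof. by move=> [lF _]; exact: (lF [::]). Qed.

Lemma contract_linear F c u v : multilinear_alt F ->
  contract (c *: u + v) F = c \*o contract u F \+ contract v F.
Proof. by move=> aF; apply/funext => t; exact: alt_linear. Qed.

Lemma altD F s t u v : multilinear_alt F ->
  F (s ++ (u + v) :: t) = F (s ++ u :: t) + F (s ++ v :: t).
Proof. by move=> [lF _]; rewrite -[u in u + v]scale1r lF mul1r. Qed.

Lemma alt0 F s t : multilinear_alt F -> F (s ++ 0 :: t) = 0.
Proof.
move=> aF; apply: (addrI (F (s ++ 0 :: t))).
by rewrite -(altD _ _ _ _ aF) !addr0.
Qed.

Lemma altZ F s t c u : multilinear_alt F ->
  F (s ++ (c *: u) :: t) = c * F (s ++ u :: t).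
Proof. by move=> aF; rewrite -[c *: u]addr0 aF.1 alt0// addr0. Qed.

Lemma alt_sum F s t (I : Type) (r : seq I) (P : pred I) (f : I -> V) :
  multilinear_alt F ->
  F (s ++ (\sum_(i <- r | P i) f i) :: t) =
    \sum_(i <- r | P i) F (s ++ f i :: t).
Proof.
move=> aF; elim: r => [|i r IH]; first by rewrite !big_nil (alt0 _ _ aF).
by rewrite !big_cons; case: (P i) => //; rewrite (altD _ _ _ _ aF) IH.
Qed.

Lemma alt_swap F s t u v : multilinear_alt F ->
  F (s ++ u :: v :: t) = - F (s ++ v :: u :: t).
Proof.
move=> aF; apply/eqP; rewrite -addr_eq0; apply/eqP.
have := aF.2 s t (u + v).
rewrite (altD s _ _ _ aF) -(cat_rcons u s) -(cat_rcons v s).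
rewrite !(altD (rcons s _) _ _ _ aF) !cat_rcons !aF.2.
by rewrite add0r addr0.
Qed.

Lemma alt_move F s t u : multilinear_alt F ->
  F (s ++ u :: t) = (-1) ^+ size s * F (u :: s ++ t).
Proof.
elim: s F => [|v s IH] F aF /=; first by rewrite mul1r.
rewrite -[LHS]/(contract v F (s ++ u :: t)) IH; last exact: contract_alt.
by rewrite /contract exprS mulN1r mulNr (alt_swap [::])// mulrN.
Qed.

Lemma lwedgeDl k a a' b s :
  lwedge k (a \+ a') b s = lwedge k a b s + lwedge k a' b s.
Proof.
elim: s k a a' b => [|v s IH] [|k] a a' b /=; rewrite ?mulrDl ?addr0//.
rewrite -[contract v (a \+ a')]/(contract v a \+ contract v a') !IH mulrDr.
by rewrite addrACA.
Qed.

Lemma lwedgeZl k c a b s : lwedge k (c \*o a) b s = c * lwedge k a b s.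
Proof.
elim: s k a b => [|v s IH] [|k] a b /=; rewrite ?mulr0 ?mulrA//.
by rewrite -[contract v (c \*o a)]/(c \*o contract v a) !IH; ring.
Qed.

Lemma lwedgeDr k a b b' s :
  lwedge k a (b \+ b') s = lwedge k a b s + lwedge k a b' s.
Proof.
elim: s k a b b' => [|v s IH] [|k] a b b' /=; rewrite ?mulrDr ?addr0//.
by rewrite -[contract v (b \+ b')]/(contract v b \+ contract v b') !IH; ring.
Qed.

Lemma lwedgeZr k c a b s : lwedge k a (c \*o b) s = c * lwedge k a b s.
Proof.
elim: s k a b => [|v s IH] [|k] a b /=; rewrite ?mulr0 ?mulrA ?[c * a _]mulrC//.
by rewrite -[contract v (c \*o b)]/(c \*o contract v b) !IH; ring.
Qed.

Lemma lwedge0l k b s : lwedge k (fun=> 0) b s = 0.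
Proof.
by elim: s k b => [|v s IH] [|k] b /=; rewrite ?mul0r ?IH ?mulr0 ?addr0.
Qed.

Lemma lwedge0r k a s : lwedge k a (fun=> 0) s = 0.
Proof.
by elim: s k a => [|v s IH] [|k] a /=; rewrite ?mulr0 ?IH ?mulr0 ?addr0.
Qed.

Lemma alt_contract_contract F u v s : multilinear_alt F ->
  contract v (contract u F) s = - contract u (contract v F) s.
Proof. by move=> aF; exact: (alt_swap [::]). Qed.

Lemma lwedge_alt k a b : multilinear_alt a -> multilinear_alt b ->
  multilinear_alt (lwedge k a b).
Proof.
move=> aa ab; split=> [s t c u v|s t u].
  elim: s k a b aa ab => [|w s IH] [|k] a b aa ab /=.
  - by rewrite alt_linear//; ring.
  - rewrite !contract_linear// lwedgeDl lwedgeZl lwedgeDr lwedgeZr; ring.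
  - by rewrite -!cat_cons ab.1; ring.
  - by rewrite !IH//; first ring; exact: contract_alt.
elim: s k a b aa ab => [|w s IH] [|k] a b aa ab /=.
- by rewrite (ab.2 [::]) mulr0.
(* Contracting either factor twice with [u] gives zero, and the two mixed terms have opposite
   signs. *)
- have z F : multilinear_alt F -> contract u (contract u F) = (fun=> 0).
    by move=> aF; apply/funext => r; exact: (aF.2 [::]).
  rewrite (z b)// lwedge0r; case: k => [|k] /=.
    by case: t => [|x t] /=; rewrite /contract; ring.
  by rewrite z// lwedge0l [(-1) ^+ k.+2]exprS; ring.
- by rewrite -cat_cons ab.2 mulr0.
- by rewrite !IH ?mulr0 ?addr0//; exact: contract_alt.
Qed.

End ListForms.

Lemma sum_iota (R : nmodType) n (g : nat -> R) :
  \sum_(i <- iota 0 n) g i = \sum_(i < n) g i.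
Proof. by rewrite -[n in iota _ n]subn0 -/(index_iota 0 n) big_mkord. Qed.

(* The sum of b(I) c(I) over the sublists I of T of length k. *)
Fixpoint pairing_incr {T : Type} {K : pzRingType} (k : nat) (I : seq T)
    (b c : seq T -> K) : K :=
  match k, I with
  | 0, _ => b [::] * c [::]
  | _.+1, [::] => 0
  | k'.+1, i :: I' =>
      pairing_incr k' I' (contract i b) (contract i c) + pairing_incr k I' b c
  end.

(** * Components in a frame and sums over multi-indices *)

Section Frames.
Context {R : realType} {V : lmodType R}.
Implicit Types (F G a b c : seq V -> R) (s t : seq V) (u v w : V) (k : nat).
Implicit Types (e f : nat -> V) (I J : seq nat).

Lemma alt_perm0 F e I J : multilinear_alt F -> perm_eq I J ->
  F (map e J) = 0 -> F (map e I) = 0.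
Proof.
elim: J F I => [|x J IH] F I aF; first by move=> /perm_nilP->.
move=> pIJ; have xI : x \in I by rewrite (perm_mem pIJ) mem_head.
case/splitPr: xI pIJ => I1 I2; rewrite perm_catC /= perm_cons perm_catC => pIJ FJ.
rewrite map_cat /= (alt_move _ _ _ aF) -map_cat -[F _]/(contract (e x) F _).
by rewrite (IH _ _ (contract_alt (e x) aF) pIJ FJ) mulr0.
Qed.

Lemma alt_nuniq F e I : multilinear_alt F -> ~~ uniq I -> F (map e I) = 0.
Proof.
elim: I F => [|x I IH] F aF //=; rewrite negb_and negbK => /orP[xI|nu].
  case/splitPr: xI => I1 I2; rewrite map_cat /= -cat_cons.
  by rewrite (alt_move _ _ _ aF) /= (aF.2 [::]) mulr0.
exact: IH (contract_alt (e x) aF) nu.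
Qed.

(** Expanding the arguments in the basis produces index lists that either have a repetition, hence
    give zero, or are permutations of an increasing list. Increasing lists are encoded as masks of
    [iota 0 n]. *)
Lemma alt_eq0_basis n F e k : multilinear_alt F ->
  (forall v, exists d : 'I_n -> R, v = \sum_i d i *: e i) ->
  (forall m, size m = n -> count id m = k ->
    F (map e (mask m (iota 0 n))) = 0) ->
  forall s, size s = k -> F s = 0.
Proof.
move=> aF eb F0.
have FI I : size I = k -> all (ltn^~ n) I -> F (map e I) = 0.
  move=> sI In; have [uI|] := boolP (uniq I); last exact: alt_nuniq.
  pose m := [seq i \in I | i <- iota 0 n].
  have pI : perm_eq I (mask m (iota 0 n)).
    rewrite -filter_mask; apply: uniq_perm => //; first by rewrite filter_uniq ?iota_uniq.
    move=> i; rewrite mem_filter mem_iota add0n /=.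
    by case iI : (i \in I) => //=; have /= -> := allP In i iI.
  apply: (alt_perm0 aF pI); apply: F0; first by rewrite size_map size_iota.
  by rewrite -sI (perm_size pI) size_mask // size_map.
(* The arguments are expanded one at a time; [I] records the basis vectors already chosen. *)
have FIs s I : (size I + size s = k)%N -> all (ltn^~ n) I -> F (map e I ++ s) = 0.
  elim: s I => [|v s IH] I; first by rewrite addn0 cats0; exact: FI.
  move=> sI In; have [d ->] := eb v; rewrite (alt_sum _ _ _ _ _ aF) big1// => i _.
  rewrite (altZ _ _ _ _ aF) -cat_rcons -map_rcons IH ?mulr0//.
    by rewrite size_rcons addSnnS.
  by rewrite all_rcons In andbT /= ltn_ord.
by move=> s sk; exact: (FIs s [::]).
Qed.

Lemma altB F G : multilinear_alt F -> multilinear_alt G ->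
  multilinear_alt (F \- G).
Proof.
move=> aF aG; split=> [s t d u v|s t u] /=; last by rewrite aF.2 aG.2 subrr.
by rewrite aF.1 aG.1; ring.
Qed.

Lemma altZf (d : R) F : multilinear_alt F -> multilinear_alt (d \*o F).
Proof.
move=> aF; split=> [s t d' u v|s t u] /=; last by rewrite aF.2 mulr0.
by rewrite aF.1; ring.
Qed.

Lemma alt_eq_basis n F G e k : multilinear_alt F -> multilinear_alt G ->
  (forall v, exists d : 'I_n -> R, v = \sum_i d i *: e i) ->
  (forall m, size m = n -> count id m = k ->
    F (map e (mask m (iota 0 n))) = G (map e (mask m (iota 0 n)))) ->
  forall s, size s = k -> F s = G s.
Proof.
move=> aF aG eb FG s sk; apply/eqP; rewrite -subr_eq0; apply/eqP.
apply: (alt_eq0_basis (altB aF aG) eb _ sk) => m sm cm /=.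
by rewrite FG// subrr.
Qed.

Section Pairing.
Variables (e f : nat -> V).

(* The sum of b(e_I) c(f_I) over all multi-indices I of length k with entries
   in T. *)
Fixpoint pairing k (T : seq nat) b c : R :=
  if k is k'.+1 then
    \sum_(i <- T) pairing k' T (contract (e i) b) (contract (f i) c)
  else b [::] * c [::].

Lemma pairingZ k T (d d' : R) b c :
  pairing k T (d \*o b) (d' \*o c) = d * d' * pairing k T b c.
Proof.
elim: k b c => [|k IH] b c /=; first by ring.
rewrite big_distrr /=; apply: eq_bigr => i _; exact: IH.
Qed.

Lemma pairingZr k T (d : R) b c : pairing k T b (d \*o c) = d * pairing k T b c.
Proof.
rewrite -[d in RHS]mul1r -pairingZ; congr pairing.
by apply/funext => s /=; rewrite mul1r.
Qed.

Lemma pairingZl k T (d : R) b c : pairing k T (d \*o b) c = d * pairing k T b c.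
Proof.
rewrite -[d in RHS]mulr1 -pairingZ; congr pairing.
by apply/funext => s /=; rewrite mul1r.
Qed.

Lemma pairingDr k T b c c' :
  pairing k T b (c \+ c') = pairing k T b c + pairing k T b c'.
Proof.
elim: k b c c' => [|k IH] b c c' /=; first by rewrite mulrDr.
by rewrite -big_split /=; apply: eq_bigr => i _; exact: IH.
Qed.

Lemma pairing0r k T b : pairing k T b (fun=> 0) = 0.
Proof.
by elim: k b => [|k IH] b /=; rewrite ?mulr0// big1// => i _; exact: IH.
Qed.

Lemma pairingDl k T b b' c :
  pairing k T (b \+ b') c = pairing k T b c + pairing k T b' c.
Proof.
elim: k b b' c => [|k IH] b b' c /=; first by rewrite mulrDl.
by rewrite -big_split /=; apply: eq_bigr => i _; exact: IH.
Qed.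

Lemma pairing0l k T b : pairing k T (fun=> 0) b = 0.
Proof.
by elim: k b => [|k IH] b /=; rewrite ?mul0r// big1// => i _; exact: IH.
Qed.

Lemma pairing_sumr k T b (n : nat) (d : 'I_n -> R) (c : 'I_n -> seq V -> R) :
  pairing k T b (fun s => \sum_i d i * c i s) =
    \sum_i d i * pairing k T b (c i).
Proof.
elim: n d c => [|n IH] d c.
  rewrite big_ord0 -[RHS](pairing0r k T b); congr pairing.
  by apply/funext => s; rewrite big_ord0.
rewrite big_ord_recl -IH -pairingZr -pairingDr; congr pairing.
by apply/funext => s; rewrite big_ord_recl.
Qed.

Lemma pairing_suml k T b (n : nat) (d : 'I_n -> R) (c : 'I_n -> seq V -> R) :
  pairing k T (fun s => \sum_i d i * c i s) b =
    \sum_i d i * pairing k T (c i) b.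
Proof.
elim: n d c => [|n IH] d c.
  rewrite big_ord0 -[RHS](pairing0l k T b); congr pairing.
  by apply/funext => s; rewrite big_ord0.
rewrite big_ord_recl -IH -pairingZl -pairingDl; congr pairing.
by apply/funext => s; rewrite big_ord_recl.
Qed.

(** By alternation the new index [t] is used at most once, in one of [k.+1] positions. All positions
    contribute equally, because moving [t] to the front changes the signs of [b] and [c]
    together. *)
Lemma pairing_cons k (t : nat) T b c : multilinear_alt b -> multilinear_alt c ->
  pairing k.+1 (t :: T) b c = pairing k.+1 T b c +
    k.+1%:R * pairing k T (contract (e t) b) (contract (f t) c).
Proof.
elim: k b c => [|k IH] b c ab ac; first by rewrite /= big_cons; ring.
have cc0 g i F : multilinear_alt F -> contract (g i) (contract (g i) F) = (fun=> 0).
  by move=> aF; apply/funext => r; exact: (aF.2 [::]).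
rewrite -[LHS]/(\sum_(i <- t :: T)
  pairing k.+1 (t :: T) (contract (e i) b) (contract (f i) c)) big_cons IH; try exact: contract_alt.
rewrite !cc0// pairing0l mulr0 addr0.
have swap i : pairing k T (contract (e t) (contract (e i) b))
                          (contract (f t) (contract (f i) c)) =
    pairing k T (contract (e i) (contract (e t) b))
                (contract (f i) (contract (f t) c)).
  rewrite -[RHS]mul1r (_ : 1 = -1 * -1); last by rewrite mulrNN mulr1.
  by rewrite -pairingZ; congr pairing; apply/funext => s /=;
    rewrite mulN1r alt_contract_contract.
rewrite (eq_bigr (fun i => pairing k.+1 T (contract (e i) b) (contract (f i) c) +
   k.+1%:R * pairing k T (contract (e i) (contract (e t) b))
                (contract (f i) (contract (f t) c)))); last first.
  by move=> i _; rewrite IH ?swap//; exact: contract_alt.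
rewrite big_split /= -big_distrr /=.
set A := \sum_(i <- T) _; set B := \sum_(i <- T) _; ring.
Qed.

Lemma pairingE k T b c : multilinear_alt b -> multilinear_alt c ->
  pairing k T b c = k`!%:R * pairing_incr k T (b \o map e) (c \o map f).
Proof.
elim: T k b c => [|t T IH] [|k] b c ab ac.
- by rewrite /= mul1r.
- by rewrite /= big_nil mulr0.
- by rewrite /= mul1r.
rewrite pairing_cons// !IH//=; try exact: contract_alt.
by rewrite factS natrM; ring.
Qed.

End Pairing.

(* The tensor \sum_i e_i (x) f_i does not depend on the choice of a pair of
   dual bases. *)
Lemma pairing_change n (P : 'M[R]_n) e f e' f' k b c :
  multilinear_alt b -> multilinear_alt c ->
  (forall j : 'I_n, e' j = \sum_i P j i *: e i) ->
  (forall i : 'I_n, f i = \sum_j P j i *: f' j) ->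
  pairing e f k (iota 0 n) b c = pairing e' f' k (iota 0 n) b c.
Proof.
move=> ab ac e'E fE; elim: k b c ab ac => [//|k IH] b c ab ac /=; rewrite !sum_iota.
transitivity (\sum_(i < n) \sum_(j < n)
    P j i * pairing e' f' k (iota 0 n) (contract (e i) b) (contract (f' j) c)).
  apply: eq_bigr => i _; rewrite IH; try exact: contract_alt.
  rewrite -pairing_sumr; congr pairing; apply/funext => s.
  rewrite fE /contract (alt_sum [::] _ _ _ _ ac).
  by apply: eq_bigr => j _; rewrite (altZ [::] _ _ _ ac).
rewrite exchange_big; apply: eq_bigr => j _ /=.
rewrite -pairing_suml; congr pairing; apply/funext => s.
rewrite e'E /contract (alt_sum [::] _ _ _ _ ab).
by apply: eq_bigr => i _; rewrite (altZ [::] _ _ _ ab).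
Qed.

End Frames.

(** * Exterior calculus *)

Section ListCalculus.
Context {R : realType} {n : nat}.
Local Notation V := 'rV[R]_n.
Implicit Types (a b W : V -> seq V -> R) (s t : seq V) (u v x : V) (k m : nat).
Implicit Types (U : set V).

(* The exterior derivative, by the rule v _| dW = D_v W - d(v _| W) for a
   constant vector field v. *)
Fixpoint ld_rec W x s : R :=
  if s is v :: s' then
    'D_v (fun y => W y s') x - ld_rec (fun y => contract v (W y)) x s'
  else 0.

Definition ld W x s := ld_rec W x s.

Definition diff_at W x := forall s, differentiable (fun y => W y s) x.

Lemma ld_cons W x v s :
  ld W x (v :: s) = 'D_v (fun y => W y s) x - ld (fun y => contract v (W y)) x s.
Proof. by []. Qed.

Lemma diff_at_contract W x v : diff_at W x -> diff_at (fun y => contract v (W y)) x.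
Proof. by move=> dW s; exact: dW. Qed.

Lemma ldD W W' x s : diff_at W x -> diff_at W' x ->
  ld (fun y => W y \+ W' y) x s = ld W x s + ld W' x s.
Proof.
elim: s W W' => [|v s IH] W W' dW dW'; first by rewrite /ld /= addr0.
rewrite !ld_cons IH; try exact: diff_at_contract.
rewrite (@deriveD _ _ _ (fun y => W y s) (fun y => W' y s)); first by ring.
- exact: diff_derivable (dW s).
- exact: diff_derivable (dW' s).
Qed.

Lemma ldZ (c : R) W x s : diff_at W x ->
  ld (fun y => c \*o W y) x s = c * ld W x s.
Proof.
elim: s W => [|v s IH] W dW; first by rewrite /ld /= mulr0.
rewrite !ld_cons IH; last exact: diff_at_contract.
rewrite (@deriveZ _ _ _ (fun y => W y s) c); first by rewrite mulrBr.
exact: diff_derivable (dW s).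
Qed.

Lemma ldB W W' x s : diff_at W x -> diff_at W' x ->
  ld (fun y => W y \- W' y) x s = ld W x s - ld W' x s.
Proof.
move=> dW dW'; rewrite -[- ld W' x s]mulN1r -ldZ// -ldD//; last first.
  by move=> t; exact: (@differentiableZ R V R (fun y => W' y t)).
by congr (ld _ x s); apply/funext => y; apply/funext => t /=; rewrite mulN1r.
Qed.

(** The comparison is confined to one degree, because closed formulas such as those for the star
    hold only on lists of the right length. *)
Lemma ld_local W W' U k x s : open U -> U x ->
  (forall y t, U y -> size t = k -> W y t = W' y t) ->
  size s = k.+1 -> ld W x s = ld W' x s.
Proof.
move=> oU Ux; elim: s k W W' => [//|v s IH] k W W' WW' [sk].
rewrite !ld_cons; congr (_ - _).
  apply: near_eq_derive; near=> y; apply: WW' => //.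
  by near: y; exact: open_nbhs_nbhs.
case: k WW' sk => [|k] WW' sk; first by rewrite (size0nil sk).
by apply: (IH k) => // y t Uy ts; apply: WW' => //=; rewrite ts.
Unshelve. all: by end_near. Qed.

Lemma ld_eq W W' U x s : open U -> U x ->
  (forall y t, U y -> W y t = W' y t) -> ld W x s = ld W' x s.
Proof.
move=> oU Ux WW'; case: s => // v s.
by apply: (ld_local (k := size s) oU Ux) => // y t Uy _; exact: WW'.
Qed.

Lemma diff_at_lwedge k a b x : diff_at a x -> diff_at b x ->
  diff_at (fun y => lwedge k (a y) (b y)) x.
Proof.
move=> da db s; elim: s k a b da db => [|v s IH] [|k] a b da db /=.
- exact: (@differentiableM R V (fun y => a y [::]) (fun y => b y [::])).
- exact: differentiable_cst.
- exact: (@differentiableM R V (fun y => a y [::]) (fun y => b y (v :: s))).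
apply: (@differentiableD R V R
   (fun y => lwedge k (contract v (a y)) (b y) s)
   (fun y => (-1) ^+ k.+1 * lwedge k.+1 (a y) (contract v (b y)) s)).
  by apply: (IH k (fun y => contract v (a y)) b) => // t; exact: da.
apply: (@differentiableZ R V R (fun y => lwedge k.+1 (a y) (contract v (b y)) s)).
by apply: (IH k.+1 a (fun y => contract v (b y))) => // t; exact: db.
Qed.

Lemma derive_lwedge k a b x v s : diff_at a x -> diff_at b x ->
  'D_v (fun y => lwedge k (a y) (b y) s) x =
    lwedge k (fun t => 'D_v (fun y => a y t) x) (b x) s +
    lwedge k (a x) (fun t => 'D_v (fun y => b y t) x) s.
Proof.
elim: s k a b => [|u s IH] [|k] a b da db /=.
- rewrite (@deriveM _ _ (fun y => a y [::]) (fun y => b y [::])).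
  + by rewrite /GRing.scale /=; ring.
  + exact: diff_derivable (da _).
  + exact: diff_derivable (db _).
- by rewrite derive_cst addr0.
- rewrite (@deriveM _ _ (fun y => a y [::]) (fun y => b y (u :: s))).
  + by rewrite /GRing.scale /=; ring.
  + exact: diff_derivable (da _).
  + exact: diff_derivable (db _).
have da' : diff_at (fun y => contract u (a y)) x by move=> t; exact: da.
have db' : diff_at (fun y => contract u (b y)) x by move=> t; exact: db.
have d1 := @diff_at_lwedge k (fun y => contract u (a y)) b x da' db s.
have d2 := @diff_at_lwedge k.+1 a (fun y => contract u (b y)) x da db' s.
rewrite (@deriveD _ _ _ (fun y => lwedge k (contract u (a y)) (b y) s)
   (fun y => (-1) ^+ k.+1 * lwedge k.+1 (a y) (contract u (b y)) s)).
- rewrite (@deriveZ _ _ _ (fun y => lwedge k.+1 (a y) (contract u (b y)) s)).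
    rewrite (IH k (fun y => contract u (a y)) b)//.
    rewrite (IH k.+1 a (fun y => contract u (b y)))//.
    rewrite /GRing.scale /= -!/(contract _ _) /contract; ring.
  exact: diff_derivable d2.
- exact: diff_derivable d1.
- apply: (@derivableZ _ _ _ (fun y => lwedge k.+1 (a y) (contract u (b y)) s)).
  exact: diff_derivable d2.
Qed.

(** Contracting with the head of the list reduces the claim to the product rule for ['D_v] and to
    the same formula for the pairs in which one factor has been contracted. *)
Lemma ld_lwedge k a b x s : diff_at a x -> diff_at b x ->
  ld (fun y => lwedge k (a y) (b y)) x s =
    lwedge k.+1 (ld a x) (b x) s + (-1) ^+ k * lwedge k (a x) (ld b x) s.
Proof.
elim: s k a b => [|v s IH] k a b da db.
  by case: k => [|k]; rewrite /ld /= ?mulr0 ?addr0.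
have da' : diff_at (fun y => contract v (a y)) x by move=> t; exact: da.
have db' : diff_at (fun y => contract v (b y)) x by move=> t; exact: db.
have c_ld W : contract v (ld W x) =
    (fun t => 'D_v (fun y => W y t) x) \- ld (fun y => contract v (W y)) x.
  by apply/funext.
have lB j (F G H : seq V -> R) : lwedge j (F \- G) H s = lwedge j F H s - lwedge j G H s.
  rewrite -[- _]mulN1r -lwedgeZl -lwedgeDl; congr lwedge.
  by apply/funext => t /=; rewrite mulN1r.
have rB j (F G H : seq V -> R) : lwedge j H (F \- G) s = lwedge j H F s - lwedge j H G s.
  rewrite -[- _]mulN1r -lwedgeZr -lwedgeDr; congr lwedge.
  by apply/funext => t /=; rewrite mulN1r.
rewrite ld_cons derive_lwedge//.
case: k => [|k].
  have -> : (fun y => contract v (lwedge 0 (a y) (b y))) =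
      (fun y => lwedge 0 (a y) (contract v (b y))).
    by apply/funext => y; apply/funext; case.
  rewrite (IH 0%N a (fun y => contract v (b y)))// lwedgeS !lwedge0 c_ld.
  by rewrite /contract /ld /=; ring.
have -> : (fun y => contract v (lwedge k.+1 (a y) (b y))) =
   (fun y => lwedge k (contract v (a y)) (b y) \+
             ((-1) ^+ k.+1 \*o lwedge k.+1 (a y) (contract v (b y)))) by [].
have d2 := @diff_at_lwedge k.+1 a (fun y => contract v (b y)) x da db'.
rewrite ldD; last 2 first.
- exact: (@diff_at_lwedge k (fun y => contract v (a y)) b x).
- move=> t; exact: (@differentiableZ R V R
    (fun y => lwedge k.+1 (a y) (contract v (b y)) t)).
rewrite ldZ// (IH k (fun y => contract v (a y)) b)//.
rewrite (IH k.+1 a (fun y => contract v (b y)))//.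
rewrite !lwedgeS !c_ld lB rB !exprS.
by rewrite -(signr_odd _ k); case: (odd k); rewrite ?expr0 ?expr1; ring.
Qed.

Lemma class_C_ld m U W : open U -> (forall s, class_C m.+1 U (fun y => W y s)) ->
  forall s, class_C m U (fun y => ld W y s).
Proof.
move=> oU cW s; elim: s W cW => [|v s IH] W cW.
  exact: (class_C_cst m U 0).
apply: class_CD => //; first exact: (cW s).2.
by apply: class_CN => //; apply: (IH (fun y => contract v (W y))) => t; exact: cW.
Qed.

Lemma derive_ld U W x v s : open U -> U x ->
  (forall t, class_C 2 U (fun y => W y t)) ->
  'D_v (fun y => ld W y s) x = ld (fun y t => 'D_v (fun z => W z t) y) x s.
Proof.
move=> oU Ux; elim: s W => [|u s IH] W cW; first exact: derive_cst.
have cW' t : class_C 2 U (fun y => contract u (W y) t) by exact: cW.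
rewrite (@deriveB _ _ _ (fun y => 'D_u (fun z => W z s) y)
  (fun y => ld (fun z => contract u (W z)) y s)).
- have e1 := derive_comm v u oU Ux (cW s).
  have e2 := IH (fun y => contract u (W y)) cW'.
  exact: (congr2 (fun p q : R => p - q) e1 e2).
- exact/diff_derivable/((cW s).2 u).1.
- exact/diff_derivable/(class_C_ld oU cW' s).1.
Qed.

(** Contracting with [v], the defining rule used twice gives D_v (dW) - d (D_v W) + d d (v _| W).
    The first two terms cancel by [derive_ld], that is, by symmetry of second derivatives, and the
    last one vanishes by induction. *)
Lemma ld_ld U W x s : open U -> U x ->
  (forall t, class_C 2 U (fun y => W y t)) -> ld (ld W) x s = 0.
Proof.
move=> oU Ux; elim: s W => [//|v s IH] W cW.
have cW' t : class_C 2 U (fun y => contract v (W y) t) by exact: cW.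
rewrite ld_cons (derive_ld _ _ oU Ux cW).
have -> : (fun y => contract v (ld W y)) =
  (fun y => (fun t => 'D_v (fun z => W z t) y) \- ld (fun z => contract v (W z)) y).
  by [].
rewrite ldB; last 2 first.
- by move=> t; exact: ((cW t).2 v).1.
- by move=> t; exact: (class_C_ld oU cW' t).1.
by rewrite (IH (fun z => contract v (W z)))// subr0 subrr.
Qed.

End ListCalculus.

(** * Translation between forms on matrices and forms on lists *)

Section Links.
Context {R : realType} {n : nat}.
Local Notation V := 'rV[R]_n.
Implicit Types (k l : nat).

Definition list_mx k (s : seq V) : 'M[R]_(k, n) := \matrix_(i < k) nth 0 s i.
Definition mx_list k (A : 'M[R]_(k, n)) : seq V := [seq row i A | i <- enum 'I_k].

(* Zero on lists of the wrong length. *)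
Definition list_form k (w : kform R n k) : seq V -> R :=
  fun s => if size s == k then w (list_mx k s) else 0.

Lemma size_mx_list k (A : 'M[R]_(k, n)) : size (mx_list A) = k.
Proof. by rewrite size_map size_enum_ord. Qed.

Lemma nth_mx_list k (A : 'M[R]_(k, n)) (i : 'I_k) : nth 0 (mx_list A) i = row i A.
Proof. by rewrite (nth_map i) ?size_enum_ord// nth_ord_enum. Qed.

Lemma mx_listK k (A : 'M[R]_(k, n)) : list_mx k (mx_list A) = A.
Proof. by apply/row_matrixP => i; rewrite rowK nth_mx_list. Qed.

Lemma list_form_mx k (w : kform R n k) (A : 'M[R]_(k, n)) :
  list_form w (mx_list A) = w A.
Proof. by rewrite /list_form size_mx_list eqxx mx_listK. Qed.

Lemma list_mx_cons k v s : list_mx k.+1 (v :: s) = col_mx v (list_mx k s).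
Proof.
apply/row_matrixP => i; rewrite rowK; case: (unliftP ord0 i) => [j ->|->].
  rewrite [in RHS](_ : lift (@ord0 k) j = rshift 1 j); last exact: val_inj.
  by rewrite (@rowKd _ 1%N k n) rowK.
rewrite [in RHS](_ : @ord0 k = lshift k (@ord0 0)); last exact: val_inj.
by rewrite (@rowKu _ 1%N k n) row_id.
Qed.

Lemma contract_list_form k (w : kform R n k.+1) v :
  contract v (list_form w) = list_form (int_prod v w).
Proof.
by apply/funext => s; rewrite /contract /list_form /= eqSS list_mx_cons.
Qed.

Lemma list_form_alt k (w : kform R n k) :
  alternating w -> multilinear_alt (list_form w).
Proof.
move=> [lw aw]; split=> [s t c u v|s t u]; rewrite /list_form !size_cat /=.
  case: eqP => [sk|_]; last by rewrite mulr0 addr0.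
  have ik : (size s < k)%N by rewrite -sk addnS ltnS leq_addr.
  have E x : list_mx k (s ++ x :: t) =
      set_row (list_mx k (s ++ 0 :: t)) (Ordinal ik) x.
    apply/row_matrixP => j; rewrite !rowK; case: eqP => [->|ij] /=.
      by rewrite nth_cat ltnn subnn.
    rewrite !nth_cat; case: ltnP => // sj.
    have : (size s != j)%N by apply/eqP => e; apply: ij; exact: val_inj.
    move=> /eqP ne; case e: (j - size s)%N => [|q] //.
    by case: ne; apply/eqP; rewrite eqn_leq sj -subn_eq0 e.
  by rewrite (E (c *: u + v)) (E u) (E v) lw.
case: eqP => [sk|//].
have ik : (size s < k)%N by rewrite -sk !addnS ltnS -addnS leq_addr.
have jk : ((size s).+1 < k)%N by rewrite -sk !addnS !ltnS leq_addr.
apply: (aw _ (Ordinal ik) (Ordinal jk)).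
  by apply/eqP => /(congr1 val)/= /eqP; rewrite ltn_eqF.
by rewrite !rowK /= !nth_cat ltnn subnn ltnNge leqnSn /= subSnn.
Qed.

Lemma alt_catr (F : seq V -> R) t : multilinear_alt F ->
  multilinear_alt (fun s => F (s ++ t)).
Proof.
move=> aF; split=> [s1 s2 c u v|s1 s2 u]; rewrite -!catA /=; first exact: aF.1.
exact: aF.2.
Qed.

Lemma pairing_ffun k (p q : nat -> V) (F G : seq V -> R) :
  \sum_(I : {ffun 'I_k -> 'I_n})
    F [seq p (I i) | i <- enum 'I_k] * G [seq q (I i) | i <- enum 'I_k] =
  pairing p q k (iota 0 n) F G.
Proof.
elim: k F G => [|k IH] F G /=.
  have e0 : enum 'I_0 = [::] by apply: size0nil; rewrite size_enum_ord.
  rewrite e0 /= sumr_const (_ : #|_| = 1%N); first by rewrite mulr1n.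
  by rewrite card_ffun !card_ord expn0.
(* A multi-index of length [k.+1] is its first entry together with the remaining ones. *)
pose h (x : 'I_n * {ffun 'I_k -> 'I_n}) : {ffun 'I_k.+1 -> 'I_n} :=
  [ffun r => if unlift ord0 r is Some r' then x.2 r' else x.1].
have hb : bijective h.
  exists (fun I : {ffun 'I_k.+1 -> 'I_n} => (I ord0, [ffun i => I (lift ord0 i)])).
    move=> [i J]; congr (_, _); first by rewrite ffunE unlift_none.
    by apply/ffunP => r; rewrite !ffunE liftK.
  move=> I; apply/ffunP => r; rewrite ffunE.
  by case: unliftP => [j|] -> //=; rewrite ffunE.
have hE (x : 'I_n * {ffun 'I_k -> 'I_n}) (p' : nat -> V) :
    [seq p' (h x i) | i <- enum 'I_k.+1] =
    p' x.1 :: [seq p' (x.2 i) | i <- enum 'I_k].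
  rewrite enum_ordSl /= ffunE unlift_none; congr (_ :: _).
  by rewrite -map_comp; apply: eq_map => i /=; rewrite ffunE liftK.
rewrite (reindex h) /=; last exact: onW_bij.
rewrite sum_iota.
rewrite -(pair_bigA _ (fun i J => F [seq p (h (i, J) r) | r <- enum 'I_k.+1] *
  G [seq q (h (i, J) r) | r <- enum 'I_k.+1])) /=.
apply: eq_bigr => i _; rewrite -[RHS]IH; apply: eq_bigr => J _.
by rewrite !hE.
Qed.

End Links.

Section ExteriorDerivative.
Context {R : realType} {n : nat}.
Local Notation V := 'rV[R]_n.
Implicit Types (k l : nat) (s t : seq V) (x u v : V).

(** The first summand of [ext_d] is the derivative along the head [v]. Deleting a later row keeps
    [v] as first argument, so the other summands form minus the derivative of [int_prod v]. *)
Lemma ext_d_list k (w : V -> kform R n k) x s : size s = k.+1 ->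
  ext_d w x (list_mx k.+1 s) = ld (fun y => list_form (w y)) x s.
Proof.
elim: k w s => [|k IH] w [//|v s] [sk]; rewrite ld_cons /ext_d big_ord_recl /=.
  rewrite big_ord0 addr0 mul1r rowK /= (size0nil sk) /ld /= subr0.
  congr ('D_v _ x); apply/funext => y; rewrite /list_form /=.
  by congr (w y); apply/matrixP => -[].
rewrite expr0 mul1r rowK /=.
have r0 : row' ord0 (list_mx k.+2 (v :: s)) = list_mx k.+1 s.
  by apply/row_matrixP => i; apply/rowP => j; rewrite !mxE.
congr ('D_v _ x + _).
  by apply/funext => y; rewrite r0 /list_form sk eqxx.
have -> : (fun y => contract v (list_form (w y))) =
    (fun y => list_form (int_prod v (w y))).
  by apply/funext => y; rewrite contract_list_form.
rewrite -IH// /ext_d -sumrN; apply: eq_bigr => i _.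
rewrite exprS mulN1r mulNr; congr (- (_ * _)).
have -> : row (lift ord0 i) (list_mx k.+2 (v :: s)) = row i (list_mx k.+1 s).
  by rewrite !rowK.
congr (derive _ x _).
have rr p q (A : 'M[R]_(p.+1, q)) a b : row b (row' a A) = row (lift a b) A.
  by apply/rowP => c; rewrite !mxE.
apply/funext => y; rewrite /int_prod; congr (w y).
apply/row_matrixP => j; rewrite rr rowK.
case: (unliftP ord0 j) => [j' ->|->].
  rewrite [in RHS](_ : lift (@ord0 k) j' = rshift 1 j'); last exact: val_inj.
  by rewrite (@rowKd _ 1%N k n) rr rowK /= /bump /= !add1n ltnS addnS.
rewrite [in RHS](_ : @ord0 k = lshift k (@ord0 0)); last exact: val_inj.
by rewrite (@rowKu _ 1%N k n) row_id.
Qed.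

(* The terms W(.., D_v X, ..), v running over the entries of the list, by which
   the Lie derivative of W along X differs from the derivative of W. *)
Fixpoint lie_terms (X : V -> V) x (F : seq V -> R) s : R :=
  if s is v :: s' then
    F ('D_v X x :: s') + lie_terms X x (contract v F) s'
  else 0.

Lemma coord_differentiable (X : V -> V) x j :
  differentiable X x -> differentiable (fun y => X y 0 j) x.
Proof.
move=> dX; apply: (@differentiable_comp _ _ _ _ X (fun M : V => M 0 j : R)) => //.
exact: differentiable_coord.
Qed.

Lemma derive_coord (X : V -> V) x v j : differentiable X x ->
  'D_v (fun y => X y 0 j) x = 'D_v X x 0 j.
Proof.
move=> dX; have dXv : derivable X x v := diff_derivable dX.
by rewrite derive_mx// mxE.
Qed.

Lemma contract_coord (F : seq V -> R) s u : multilinear_alt F ->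
  F (u :: s) = \sum_j u 0 j * F (delta_mx 0 j :: s).
Proof.
move=> aF; rewrite {1}[u]row_sum_delta (alt_sum [::] _ _ _ _ aF).
by apply: eq_bigr => j _; rewrite (altZ [::] _ _ _ aF).
Qed.

(** The inserted vector moves with the point. Expanding it in coordinates leaves products of a
    coordinate of [X] with [W] at fixed arguments. *)
Lemma differentiable_contract (W : V -> seq V -> R) (X : V -> V) U x s :
  open U -> U x -> (forall y, U y -> multilinear_alt (W y)) ->
  diff_at W x -> differentiable X x -> differentiable (fun y => W y (X y :: s)) x.
Proof.
move=> oU Ux aW dW dX.
apply: (@near_eq_differentiable R V R
  (\sum_(j < n) (fun y => X y 0 j * W y (delta_mx 0 j :: s)))).
  near=> y; rewrite fct_sumE [RHS]contract_coord//; apply: aW.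
  by near: y; exact: open_nbhs_nbhs.
apply: differentiable_sum => j.
apply: (@differentiableM R V (fun y => X y 0 j) (fun y => W y (delta_mx 0 j :: s))).
  exact: coord_differentiable.
exact: dW.
Unshelve. all: by end_near. Qed.

Lemma derive_contract (W : V -> seq V -> R) (X : V -> V) U x v s :
  open U -> U x -> (forall y, U y -> multilinear_alt (W y)) ->
  diff_at W x -> differentiable X x ->
  'D_v (fun y => W y (X y :: s)) x =
    'D_v (fun y => W y (X x :: s)) x + W x ('D_v X x :: s).
Proof.
move=> oU Ux aW dW dX.
have dXj j : derivable (fun y => X y 0 j) x v.
  exact/diff_derivable/coord_differentiable.
have dWj j : derivable (fun y => W y (delta_mx 0 j :: s)) x v.
  exact/diff_derivable/dW.
(* The same expansion serves the field [X] and the constant field [X x]. *)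
have E (Y : V -> V) : 'D_v (fun y => W y (Y y :: s)) x =
    'D_v (\sum_(j < n) (fun y => Y y 0 j * W y (delta_mx 0 j :: s))) x.
  apply: near_eq_derive; near=> y; rewrite fct_sumE [LHS]contract_coord//; apply: aW.
  by near: y; exact: open_nbhs_nbhs.
rewrite E (E (fun=> X x)) derive_sum; last by move=> j; exact: derivableM.
rewrite derive_sum; last by move=> j; exact/derivableM/dWj/derivable_cst.
rewrite (contract_coord _ _ (aW x Ux)) -big_split; apply: eq_bigr => j _ /=.
rewrite (deriveM (dXj j) (dWj j)) (deriveM (derivable_cst (X x 0 j) x v) (dWj j)).
by rewrite derive_cst derive_coord// /GRing.scale /= /cst; ring.
Unshelve. all: by end_near. Qed.

(** For the constant field [X x] the formula is the recursion defining [ld]. The variation of [X]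
    contributes exactly [lie_terms], by induction on the list. *)
Lemma cartan_list (W : V -> seq V -> R) (X : V -> V) U x s :
  open U -> U x -> (forall y, U y -> multilinear_alt (W y)) ->
  diff_at W x -> differentiable X x ->
  ld (fun y => contract (X y) (W y)) x s + ld W x (X x :: s) =
    'D_(X x) (fun y => W y s) x + lie_terms X x (W x) s.
Proof.
move=> oU Ux aW dW dX.
suff -> : ld (fun y => contract (X y) (W y)) x s =
    ld (fun y => contract (X x) (W y)) x s + lie_terms X x (W x) s.
  by rewrite [ld W x (X x :: s)]ld_cons; ring.
elim: s W aW dW => [|v s IH] W aW dW; first by rewrite /ld /= addr0.
have aW' y : U y -> multilinear_alt (contract v (W y)).
  by move=> Uy; exact/contract_alt/aW.
have dW' : diff_at (fun y => contract v (W y)) x by move=> t; exact: dW.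
(* Interior products anticommute, so [v] can be contracted first and the induction hypothesis
   applied to [contract v (W y)]. *)
have sw (Y : V -> V) : differentiable Y x ->
    ld (fun y => contract v (contract (Y y) (W y))) x s =
    - ld (fun y => contract (Y y) (contract v (W y))) x s.
  move=> dY; rewrite -mulN1r -ldZ; last first.
    by move=> t; exact: (differentiable_contract _ oU Ux aW' dW' dY).
  apply: (ld_eq _ oU Ux) => y t Uy /=; rewrite mulN1r.
  by rewrite alt_contract_contract//; exact: aW.
rewrite [LHS]ld_cons [X in _ = X + _]ld_cons sw// (sw (fun=> X x))//.
rewrite (IH _ aW' dW') /= {1}/contract (derive_contract _ _ oU Ux aW dW dX).
by rewrite /contract; ring.
Qed.

Lemma set_row_cons k v s (i : 'I_k) u :
  set_row (list_mx k.+1 (v :: s)) (lift ord0 i) u =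
    col_mx v (set_row (list_mx k s) i u).
Proof.
apply/row_matrixP => j; rewrite rowK; case: (unliftP ord0 j) => [j' ->|->].
  rewrite [in RHS](_ : lift (@ord0 k) j' = rshift 1 j'); last exact: val_inj.
  by rewrite (@rowKd _ 1%N k n) (inj_eq lift_inj) !rowK.
rewrite [in RHS](_ : @ord0 k = lshift k (@ord0 0)); last exact: val_inj.
by rewrite (@rowKu _ 1%N k n) row_id rowK.
Qed.

Lemma lie_terms_sum k (X : V -> V) x (w : kform R n k) s : size s = k ->
  \sum_(i < k) w (set_row (list_mx k s) i ('D_(row i (list_mx k s)) X x)) =
    lie_terms X x (list_form w) s.
Proof.
elim: k w s => [|k IH] w [|v s] //; first by rewrite big_ord0.
move=> [sk]; rewrite big_ord_recl; congr (_ + _).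
  rewrite /list_form /= sk eqxx; congr (w _); apply/row_matrixP => j.
  by rewrite !rowK; case: (unliftP ord0 j) => [j' ->|->].
rewrite -[RHS]/(lie_terms X x (contract v (list_form w)) s).
rewrite contract_list_form -IH//; apply: eq_bigr => i _.
by rewrite set_row_cons /int_prod !rowK.
Qed.

Lemma lie_list k (X : V -> V) (w : V -> kform R n k) x s : size s = k ->
  lie X w x (list_mx k s) =
    'D_(X x) (fun y => list_form (w y) s) x +
    lie_terms X x (list_form (w x)) s.
Proof.
move=> sk; rewrite /lie lie_terms_sum//; congr (_ + _).
congr (derive _ x _); apply/funext => y.
by rewrite /list_form sk eqxx.
Qed.

End ExteriorDerivative.

(** * The Hodge star *)

Section HodgeStar.
Context {R : realType} {n' : nat}.
Local Notation n := n'.+1.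
Local Notation V := 'rV[R]_n.
Implicit Types (k l : nat) (s t : seq V) (x u v : V) (A E : 'M[R]_n).

Lemma row'_set_row k (W : 'M[R]_(k.+1, n)) i u : row' i (set_row W i u) = row' i W.
Proof. by apply/matrixP => a b; rewrite !mxE eq_sym (negbTE (neq_lift _ _)) mxE. Qed.

Lemma row_set_row k (W : 'M[R]_(k, n)) i u : row i (set_row W i u) = u.
Proof. by rewrite rowK eqxx. Qed.

Lemma alternating_det : alternating (determinant : kform R n n).
Proof.
split=> [W i c u v|W i j ij Wij].
  rewrite -[X in _ = _ + X]mul1r; apply: (@determinant_multilinear _ _ _ _ _ i).
  - by rewrite !row_set_row scale1r.
  - exact: etrans (row'_set_row _ _ _) (esym (row'_set_row _ _ _)).
  - exact: etrans (row'_set_row _ _ _) (esym (row'_set_row _ _ _)).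
apply: (determinant_alternate ij) => c.
by move/rowP : Wij => /(_ c); rewrite !mxE.
Qed.

Lemma alternating_pullback k A (w : kform R n k) :
  alternating w -> alternating (pullback A w).
Proof.
move=> [lw aw]; split=> [W i c u v|W i j ij Wij].
  have E x : set_row W i x *m A = set_row (W *m A) i (x *m A).
    by apply/row_matrixP => j; rewrite row_mul !rowK; case: eqP => // _; rewrite row_mul.
  by rewrite /pullback !E mulmxDl -scalemxAl lw.
by apply: (aw _ i j) => //; rewrite !row_mul Wij.
Qed.

Definition lvol A : seq V -> R := list_form (pullback A determinant : kform R n n).

Lemma lvol_alt A : multilinear_alt (lvol A).
Proof. exact/list_form_alt/alternating_pullback/alternating_det. Qed.

(** Indices are natural numbers so that lists of them can be computed with. *)
Definition frame E (i : nat) : V := row (inord i) E.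

Lemma frame_span A E : A *m E = 1%:M -> forall v,
  exists d : 'I_n -> R, v = \sum_i d i *: frame E i.
Proof.
move=> AE v; exists (fun i => (v *m A) 0 i).
rewrite -[LHS]mulmx1 -AE mulmxA mulmx_sum_row; apply: eq_bigr => i _.
by rewrite /frame inord_val.
Qed.

(** When [A *m E = 1%:M], the rows of [E] are orthonormal for the metric [A *m A^T] and have volume
    1, and this is the star computed in an oriented orthonormal frame. *)
Definition lstar A E k (b : seq V -> R) s : R :=
  pairing_incr k (iota 0 n) (b \o map (frame E))
    ((fun t => lvol A (t ++ s)) \o map (frame E)).

Lemma mx_list_rowsub k (I : 'I_k -> 'I_n) E :
  mx_list (rowsub I E) = [seq frame E (I i) | i <- enum 'I_k].
Proof.
by apply: eq_map => i; rewrite /frame inord_val; apply/rowP => c; rewrite !mxE.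
Qed.

Lemma mx_list_cat k l (P : 'M[R]_(k, n)) (Q : 'M[R]_(l, n)) :
  list_mx (k + l) (mx_list P ++ mx_list Q) = col_mx P Q.
Proof.
apply/row_matrixP => i; rewrite rowK nth_cat size_mx_list.
case: (split_ordP i) => j -> /=.
  by rewrite rowKu nth_mx_list.
by rewrite addKn rowKd nth_mx_list.
Qed.

Lemma conform_list_mx (p q : nat) s : q = p ->
  conform_mx (0 : 'M[R]_(p, n)) (list_mx q s) = list_mx p s.
Proof. by move=> ->; rewrite conform_mx_id. Qed.

(** The inverse Gram matrix is [E^T *m E], so the standard basis and its reciprocal form a dual
    pair, which [pairing_change] replaces by [frame E] paired with itself. The factor k! then passes
    from all multi-indices to increasing ones. *)
Lemma hodge_star_frame A E k l (b : kform R n k) (W : 'M[R]_(l, n)) :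
  A *m E = 1%:M -> (k + l = n)%N -> multilinear_alt (list_form b) ->
  hodge_star (A *m A^T) (pullback A determinant) l b W =
    lstar A E k (list_form b) (mx_list W).
Proof.
move=> AE kl ab; have EA := mulmx1C AE.
have gV : invmx (A *m A^T) = E^T *m E.
  have uA : A *m A^T \in unitmx.
    by rewrite unitmx_mul unitmx_tr andbb; exact: (mulmx1_unit AE).1.
  apply: (can_inj (mulKmx uA)); rewrite mulmxV// mulmxA -[_ *m _ *m E^T]mulmxA.
  by rewrite -trmx_mul EA trmx1 mulmx1 AE.
rewrite /hodge_star gV.
have volE (Q : 'M[R]_(k, n)) :
    pullback A determinant (conform_mx 0 (col_mx Q W)) =
    lvol A (mx_list Q ++ mx_list W).
  rewrite /lvol /list_form size_cat !size_mx_list (introT eqP kl); congr (pullback _ _ _).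
  by rewrite -mx_list_cat conform_list_mx.
under eq_bigr do rewrite volE -list_form_mx !mx_list_rowsub.
have aG := alt_catr (mx_list W) (lvol_alt A).
rewrite (pairing_ffun k (frame 1%:M) (frame (E^T *m E)) (list_form b)
  (fun t => lvol A (t ++ mx_list W))).
rewrite (@pairing_change _ _ n E _ _ (frame E) (frame E))//.
- by rewrite pairingE// mulKf// pnatr_eq0 -lt0n fact_gt0.
- move=> j; rewrite -[frame E j]mulmx1 mulmx_sum_row.
  by apply: eq_bigr => i _; rewrite /frame !inord_val mxE.
- move=> i; rewrite /frame inord_val row_mul mulmx_sum_row.
  by apply: eq_bigr => j _; rewrite inord_val !mxE.
Qed.

Lemma form_inner_frame A E k (a b : kform R n k) :
  A *m E = 1%:M -> multilinear_alt (list_form a) -> multilinear_alt (list_form b) ->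
  form_inner (A *m A^T) a b =
    pairing_incr k (iota 0 n) (list_form a \o map (frame E))
      (list_form b \o map (frame E)).
Proof.
move=> AE aa ab; have EA := mulmx1C AE.
have gV : invmx (A *m A^T) = E^T *m E.
  have uA : A *m A^T \in unitmx.
    by rewrite unitmx_mul unitmx_tr andbb; exact: (mulmx1_unit AE).1.
  apply: (can_inj (mulKmx uA)); rewrite mulmxV// mulmxA -[_ *m _ *m E^T]mulmxA.
  by rewrite -trmx_mul EA trmx1 mulmx1 AE.
rewrite /form_inner gV.
under eq_bigr do rewrite -!list_form_mx !mx_list_rowsub.
rewrite (pairing_ffun k (frame 1%:M) (frame (E^T *m E))).
rewrite (@pairing_change _ _ n E _ _ (frame E) (frame E))//.
- by rewrite pairingE// mulKf// pnatr_eq0 -lt0n fact_gt0.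
- move=> j; rewrite -[frame E j]mulmx1 mulmx_sum_row.
  by apply: eq_bigr => i _; rewrite /frame !inord_val mxE.
- move=> i; rewrite /frame inord_val row_mul mulmx_sum_row.
  by apply: eq_bigr => j _; rewrite inord_val !mxE.
Qed.

Lemma pairing_incr_alt (e : nat -> V) k (I : seq nat) (b : seq nat -> R)
    (F : seq V -> R) : multilinear_alt F ->
  multilinear_alt (fun s => pairing_incr k I b ((fun t => F (t ++ s)) \o map e)).
Proof.
elim: I k b F => [|i I IH] [|k] b F aF /=.
- split=> [s t c u v|s t u] /=; last by rewrite aF.2 mulr0.
  by rewrite aF.1; ring.
- by split=> [s t c u v|s t u]; rewrite ?mulr0 ?addr0.
- split=> [s t c u v|s t u] /=; last by rewrite aF.2 mulr0.
  by rewrite aF.1; ring.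
have [l1 a1] := IH k (contract i b) (contract (e i) F) (contract_alt (e i) aF).
have [l2 a2] := IH k.+1 b F aF.
split=> [s t c u v|s t u].
  have := l1 s t c u v; have := l2 s t c u v; rewrite /contract /= => -> ->.
  by ring.
have := a1 s t u; have := a2 s t u; rewrite /contract /= => -> ->.
by rewrite addr0.
Qed.

Lemma lstar_alt A E k b : multilinear_alt (lstar A E k b).
Proof. exact/pairing_incr_alt/lvol_alt. Qed.

Lemma top_form A E F s : A *m E = 1%:M -> multilinear_alt F -> size s = n ->
  F s = F (map (frame E) (iota 0 n)) * lvol A s.
Proof.
move=> AE aF sn; have aV := altZf (F (map (frame E) (iota 0 n))) (lvol_alt A).
apply: (alt_eq_basis aF aV (frame_span AE) _ sn) => m sm cm.
rewrite -[RHS]/(F _ * lvol A _).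
(* Only one increasing list of indices below [n] has length [n]. *)
have -> : m = nseq n true.
  have /all_pred1P : all (pred1 true) m.
    by rewrite all_count sm -cm; apply/eqP/eq_count => -[].
  by rewrite sm.
rewrite mask_true ?size_iota// (_ : lvol A _ = 1) ?mulr1//.
rewrite /lvol /list_form size_map size_iota eqxx /pullback.
rewrite (_ : list_mx _ _ = E) ?(mulmx1C AE) ?det1//.
apply/row_matrixP => i; rewrite rowK (nth_map 0%N) ?size_iota//.
by rewrite nth_iota// add0n /frame inord_val.
Qed.

End HodgeStar.

(** * Components with respect to a basis *)

Section Index.
Context {R : comRingType}.
Implicit Types (I J s t : seq nat) (k : nat).

Fixpoint subs k I : seq (seq nat) :=
  match k, I with
  | 0, _ => [:: [::]]
  | _.+1, [::] => [::]
  | k'.+1, i :: I' => [seq i :: s | s <- subs k' I'] ++ subs k I'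
  end.

(* The splittings of I into a sublist of length k and its complement, with the
   signs of the corresponding shuffles. *)
Fixpoint splits k I : seq (int * (seq nat * seq nat)) :=
  match k, I with
  | 0, _ => [:: (1, ([::], I))]
  | _.+1, [::] => [::]
  | k'.+1, i :: I' =>
      [seq (q.1, (i :: q.2.1, q.2.2)) | q <- splits k' I'] ++
      [seq ((-1) ^+ k * q.1, (q.2.1, i :: q.2.2)) | q <- splits k I']
  end.

Lemma mem_subs_mask m I : size m = size I -> mask m I \in subs (count id m) I.
Proof.
elim: I m => [|i I IH] [|[] m] //= [sm].
  by rewrite mem_cat map_f ?IH.
have := IH m sm; rewrite add0n; case: (count id m) => [|c] //=.
  by case: (I).
by rewrite mem_cat => ->; rewrite orbT.
Qed.

Lemma pairing_incr_subs k I (b c : seq nat -> R) :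
  pairing_incr k I b c = \sum_(s <- subs k I) b s * c s.
Proof.
elim: I k b c => [|i I IH] [|k] b c /=; rewrite ?big_seq1 ?big_nil//.
by rewrite !IH big_cat big_map.
Qed.

Lemma lwedge_splits k I (a b : seq nat -> R) :
  lwedge k a b I = \sum_(q <- splits k I) q.1%:~R * (a q.2.1 * b q.2.2).
Proof.
elim: I k a b => [|i I IH] [|k] a b /=; rewrite ?big_seq1 ?big_nil ?mul1r//.
rewrite !IH big_cat !big_map; congr (_ + _).
by rewrite big_distrr; apply: eq_bigr => q _ /=; rewrite rmorphM rmorphXn /= rmorphN1 mulrA.
Qed.

Definition lin_eval (t : seq nat -> R) (l : seq (int * seq nat)) : R :=
  \sum_(q <- l) q.1%:~R * t q.2.

Definition coef (l : seq (int * seq nat)) (p : seq nat) : int :=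
  foldr (fun q z => if q.2 == p then q.1 + z else z) 0 l.

Lemma lin_evalE (t : seq nat -> R) l (S : seq (seq nat)) : uniq S -> all (fun q => q.2 \in S) l ->
  lin_eval t l = \sum_(p <- S) (coef l p)%:~R * t p.
Proof.
move=> uS; elim: l => [|q l IH] /=.
  by rewrite /lin_eval big_nil big1// => p _; rewrite mul0r.
move=> /andP[qS lS]; rewrite /lin_eval big_cons -/(lin_eval t l) IH//.
rewrite (bigD1_seq q.2)//= [in RHS](bigD1_seq q.2)//= eqxx rmorphD mulrDl -addrA.
congr (_ + (_ + _)); apply: eq_bigr => p pq.
by rewrite eq_sym (negbTE pq).
Qed.

(** An identity between linear forms in unknown components [t] is reduced to a comparison of integer
    coefficients, which can be evaluated. *)
Lemma lin_eval_eq (t : seq nat -> R) l l' (S : seq (seq nat)) : uniq S ->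
  all (fun q => q.2 \in S) l -> all (fun q => q.2 \in S) l' ->
  all (fun p => coef l p == coef l' p) S -> lin_eval t l = lin_eval t l'.
Proof.
move=> uS lS lS' ll'; rewrite (lin_evalE _ uS lS) (lin_evalE _ uS lS').
by apply: eq_big_seq => p pS; rewrite (eqP (allP ll' p pS)).
Qed.

Lemma lin_eval_cat (t : seq nat -> R) l l' : lin_eval t (l ++ l') = lin_eval t l + lin_eval t l'.
Proof. by rewrite /lin_eval big_cat. Qed.

Lemma lin_evalZ (t : seq nat -> R) (c : int) l :
  lin_eval t [seq (c * q.1, q.2) | q <- l] = c%:~R * lin_eval t l.
Proof.
rewrite /lin_eval big_map big_distrr; apply: eq_bigr => q _ /=.
by rewrite rmorphM mulrA.
Qed.

Lemma lwedge_lin k I (a : seq nat -> R) (b : seq nat -> int) :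
  lwedge k a (fun s => (b s)%:~R) I =
    lin_eval a [seq (q.1 * b q.2.2, q.2.1) | q <- splits k I].
Proof.
rewrite lwedge_splits /lin_eval big_map; apply: eq_bigr => q _ /=.
by rewrite rmorphM; ring.
Qed.

Lemma lwedge_int k I (a b : seq nat -> int) :
  lwedge k (fun s => (a s)%:~R) (fun s => (b s)%:~R) I = (lwedge k a b I)%:~R :> R.
Proof.
elim: I k a b => [|i I IH] [|k] a b //=; rewrite ?rmorphM// rmorphD rmorphM.
by rewrite rmorphXn rmorphN1 /= -!IH.
Qed.

Lemma lwedge_eq_splits k I (a b a' b' : seq nat -> R) :
  (forall q, q \in splits k I -> a q.2.1 = a' q.2.1) ->
  (forall q, q \in splits k I -> b q.2.2 = b' q.2.2) ->
  lwedge k a b I = lwedge k a' b' I.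
Proof.
move=> aa bb; rewrite !lwedge_splits; apply: eq_big_seq => q qS.
by rewrite aa// bb.
Qed.

End Index.

Lemma lwedge_map {T : Type} {K : pzRingType} k (e : nat -> T) (a b : seq T -> K) I :
  lwedge k a b (map e I) = lwedge k (a \o map e) (b \o map e) I.
Proof. by elim: I k a b => [|i I IH] [|k] a b //=; rewrite !IH. Qed.

Lemma lwedge_eq_size {T : Type} {K : pzRingType} k (a b a' b' : seq T -> K) s :
  (forall t, size t = k -> a t = a' t) ->
  (forall t, (size t + k)%N = size s -> b t = b' t) ->
  lwedge k a b s = lwedge k a' b' s.
Proof.
elim: s k a b a' b' => [|v s IH] [|k] a b a' b' aa bb //=.
- by rewrite aa// bb.
- by rewrite aa// bb//= addn0.
congr (_ + _ * _); apply: IH => // t st; rewrite ?/(contract _ _).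
- by rewrite /contract aa//= st.
- by rewrite bb// addnS st.
- by rewrite /contract bb//= addSn st.
Qed.

(** * Signs of index lists, and reduction of identities to frame vectors *)

Section Sorting.
Implicit Types (I J s t : seq nat) (k : nat).

Fixpoint insert_sign (x : nat) s : bool * seq nat :=
  if s is y :: s' then
    if (x <= y)%N then (false, x :: s)
    else let: (b, r) := insert_sign x s' in (~~ b, y :: r)
  else (false, [:: x]).

Fixpoint sort_sign s : bool * seq nat :=
  if s is x :: s' then
    let: (b, r) := sort_sign s' in
    let: (b', r') := insert_sign x r in (b (+) b', r')
  else (false, [::]).

Context {R : realType} {V : lmodType R}.
Implicit Types (F : seq V -> R) (e : nat -> V).

Lemma alt_insert F e x s : multilinear_alt F ->
  F (e x :: map e s) =
    (-1) ^+ (insert_sign x s).1 * F (map e (insert_sign x s).2).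
Proof.
elim: s F => [|y s IH] F aF /=; first by rewrite mul1r.
case: leqP => _ /=; first by rewrite mul1r.
have := IH _ (contract_alt (e y) aF); case: (insert_sign x s) => b r /=.
rewrite /contract => IH'; rewrite (alt_swap [::])//= IH'.
by case: b {IH'} => /=; rewrite ?expr0 ?expr1; ring.
Qed.

Lemma alt_sort F e s : multilinear_alt F ->
  F (map e s) = (-1) ^+ (sort_sign s).1 * F (map e (sort_sign s).2).
Proof.
elim: s F => [|x s IH] F aF /=; first by rewrite mul1r.
have := IH _ (contract_alt (e x) aF); case: (sort_sign s) => b r /=.
rewrite /contract => ->; rewrite (alt_insert e x r aF).
case: (insert_sign x r) => b' r' /=.
by rewrite mulrA signr_addb.
Qed.

Lemma alt_eq_subs n F G e k : multilinear_alt F -> multilinear_alt G ->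
  (forall v, exists d : 'I_n -> R, v = \sum_i d i *: e i) ->
  (forall J, J \in subs k (iota 0 n) -> F (map e J) = G (map e J)) ->
  forall s : seq V, size s = k -> F s = G s.
Proof.
move=> aF aG eb FG; apply: (alt_eq_basis aF aG eb) => m sm cm; apply: FG.
by rewrite -cm mem_subs_mask ?size_iota.
Qed.

(** This treats the contracted vector, in which the identities are linear, as [alt_eq_subs] treats
    the arguments. *)
Lemma linear_eq_basis n (f g : V -> R) e :
  (forall c u v, f (c *: u + v) = c * f u + f v) ->
  (forall c u v, g (c *: u + v) = c * g u + g v) ->
  (forall v, exists d : 'I_n -> R, v = \sum_i d i *: e i) ->
  (forall i, (i < n)%N -> f (e i) = g (e i)) -> forall v, f v = g v.
Proof.
move=> lf lg eb fg v; have [d ->] := eb v.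
have z h : (forall c u w, h (c *: u + w) = c * h u + h w) -> h 0 = 0 :> R.
  by move=> lh; have := lh (-1) 0 0; rewrite scaler0 addr0 => ->; ring.
apply: (big_ind (fun u => f u = g u)); first by rewrite (z _ _ lf) (z _ _ lg).
- by move=> u w fu fw; rewrite -[u]scale1r lf lg fu fw.
- by move=> i _; rewrite -[_ *: _]addr0 lf lg fg// (z _ _ lf) (z _ _ lg).
Qed.

End Sorting.

(** This is the volume form on frame vectors, meant for lists that permute 0, ..., 6 or have a
    repetition. *)
Definition vol_index (I : seq nat) : int :=
  if uniq I then (-1) ^+ (sort_sign I).1 else 0.

Definition compl7 (J : seq nat) : seq nat := [seq i <- iota 0 7 | i \notin J].

(* The value of dx^l on the standard basis vectors with indices I. *)
Definition dx_index (l I : seq nat) : int :=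
  let m r s : int := (nth 0%N I r == (nth 0%N l s).-1)%:R in
  m 0 0 * (m 1 1 * m 2 2 - m 1 2 * m 2 1)
  - m 0 1 * (m 1 0 * m 2 2 - m 1 2 * m 2 0)
  + m 0 2 * (m 1 0 * m 2 1 - m 1 1 * m 2 0).

Definition phi_index (I : seq nat) : int :=
  dx_index [:: 1; 2; 3] I - dx_index [:: 1; 6; 7] I - dx_index [:: 5; 2; 7] I
  - dx_index [:: 5; 6; 3] I + dx_index [:: 4; 1; 5] I + dx_index [:: 4; 2; 6] I
  + dx_index [:: 4; 3; 7] I.

Definition psi_index (J : seq nat) : int :=
  vol_index (compl7 J ++ J) * phi_index (compl7 J).

(* The component of [tau /\ phi + * tau] at [K], a linear form in those of tau. *)
Definition tau_relation (K : seq nat) : seq (int * seq nat) :=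
  (vol_index (compl7 K ++ K), compl7 K) ::
  [seq (q.1 * phi_index q.2.2, q.2.1) | q <- splits 2 K].

(* The linear form <e_i _| phi, tau> in the components of tau. *)
Definition phi_row (i : nat) : seq (int * seq nat) :=
  [seq (phi_index (i :: p), p) | p <- subs 2 (iota 0 7)].

(** Guarantees that [lstar] on the frame vectors of [J] reduces to the term of [compl7 J]: every
    other sublist of length [k] meets [J], and the volume form vanishes there. *)
Definition star_check (k l : nat) : bool :=
  all (fun J => [&& compl7 J \in subs k (iota 0 7), uniq (compl7 J ++ J),
      (sort_sign (compl7 J ++ J)).2 == iota 0 7 &
      all (fun s => (s == compl7 J) || ~~ uniq (s ++ J)) (subs k (iota 0 7))])
    (subs l (iota 0 7)) && uniq (subs k (iota 0 7)).

Lemma star_check34 : star_check 3 4. Proof. by vm_compute. Qed.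
Lemma star_check25 : star_check 2 5. Proof. by vm_compute. Qed.
Lemma star_check52 : star_check 5 2. Proof. by vm_compute. Qed.

Lemma compl_check4 :
  all (fun J => (size (compl7 J) == 3) && all (gtn 7) (compl7 J)) (subs 4 (iota 0 7)).
Proof. by vm_compute. Qed.

(** The product of the two signs is what makes the star an involution on 2-forms. *)
Lemma compl_check2 : all (fun J => [&& compl7 J \in subs 5 (iota 0 7),
    compl7 (compl7 J) == J &
    vol_index (compl7 J ++ J) * vol_index (J ++ compl7 J) == 1])
  (subs 2 (iota 0 7)).
Proof. by vm_compute. Qed.

Lemma subs2_check : all (fun s => (size s == 2) && all (gtn 7) s) (subs 2 (iota 0 7)).
Proof. by vm_compute. Qed.

Lemma subs2_uniq : uniq (subs 2 (iota 0 7)).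
Proof. by vm_compute. Qed.

(* These boolean checks also record the side conditions (lengths, indices below 7)
   under which [phi_index] and [psi_index] give the components of the forms. *)
Lemma contract_psi_check : all (fun J => all (fun i =>
  [&& lwedge 2 (contract i phi_index) psi_index J == 3 * vol_index (i :: J),
    ~~ uniq (i :: J) || uniq (i :: J) && ((sort_sign (i :: J)).2 == iota 0 7) &
    all (fun q => [&& size q.2.1 == 2, all (gtn 7) q.2.1 &
      q.2.2 \in subs 4 (iota 0 7)]) (splits 2 J)])
  (iota 0 7)) (subs 6 (iota 0 7)).
Proof. by vm_compute. Qed.

Lemma phi_contract_check : all (fun J => all (fun i =>
  [&& lwedge 3 phi_index (contract i phi_index) J ==
        2 * (vol_index (compl7 J ++ J) * phi_index (i :: compl7 J)),
    size (compl7 J) == 2, all (gtn 7) (compl7 J) &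
    all (fun q => [&& size q.2.1 == 3, all (gtn 7) q.2.1,
      size q.2.2 == 2 & all (gtn 7) q.2.2]) (splits 3 J)])
  (iota 0 7)) (subs 5 (iota 0 7)).
Proof. by vm_compute. Qed.

(** For a /\ *b = <a, b> vol on 2-forms: the sign of the shuffle cancels the sign in the star. *)
Lemma splits_check :
  ([seq q.2.1 | q <- splits 2 (iota 0 7)] == subs 2 (iota 0 7)) &&
  all (fun q => [&& q.2.2 \in subs 5 (iota 0 7), compl7 q.2.2 == q.2.1 &
    q.1 * vol_index (q.2.1 ++ q.2.2) == 1]) (splits 2 (iota 0 7)).
Proof. by vm_compute. Qed.

(** Each index occurs in three of the seven triples of phi_0, whence the 3. Each pair of indices
    lies in exactly one triple, so contractions with different frame vectors have no common term. *)
Lemma pairing_check : all (fun i => all (fun j =>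
    foldr (fun s z => phi_index (i :: s) * phi_index (j :: s) + z) 0
      (subs 2 (iota 0 7)) == 3 * (j == i)%:R)
  (iota 0 7)) (iota 0 7).
Proof. by vm_compute. Qed.

Lemma phi_psi_check : (lwedge 3 phi_index psi_index (iota 0 7) == 7) &&
  all (fun q => [&& size q.2.1 == 3, all (gtn 7) q.2.1 &
    q.2.2 \in subs 4 (iota 0 7)]) (splits 3 (iota 0 7)).
Proof. by vm_compute. Qed.

Lemma tau_check : all (fun K => (size K == 5) &&
    all (fun q => (size q.2.2 == 3) && all (gtn 7) q.2.2) (splits 2 K))
  (subs 5 (iota 0 7)).
Proof. by vm_compute. Qed.

(* Projecting the 21 relations contained in [tau /\ phi = - * tau] to the
   7-dimensional component gives 3 < e_i _| phi, tau > = 0. *)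
Lemma phi_row_check : all (fun i =>
  let l := flatten [seq [seq (vol_index (compl7 K ++ K) * phi_index (i :: compl7 K)
      * q.1, q.2) | q <- tau_relation K] | K <- subs 5 (iota 0 7)] in
  let l' := [seq (3 * q.1, q.2) | q <- phi_row i] in
  [&& all (fun q => q.2 \in subs 2 (iota 0 7)) l,
      all (fun q => q.2 \in subs 2 (iota 0 7)) l' &
      all (fun p => coef l p == coef l' p) (subs 2 (iota 0 7))]) (iota 0 7).
Proof. by vm_compute. Qed.

(** With [i] the one index missing from [J], the component of tau /\ psi at [J] is, up to sign, <e_i
    _| phi, tau>. *)
Lemma tau_psi_check : all (fun J =>
  let l := [seq (q.1 * psi_index q.2.2, q.2.1) | q <- splits 2 J] in
  let i := head 0%N (compl7 J) in
  let l' := [seq (vol_index (compl7 J ++ J) * q.1, q.2) | q <- phi_row i] in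
  [&& all (fun q => q.2 \in subs 2 (iota 0 7)) l,
      all (fun q => q.2 \in subs 2 (iota 0 7)) l',
      all (fun p => coef l p == coef l' p) (subs 2 (iota 0 7)),
      all (fun q => q.2.2 \in subs 4 (iota 0 7)) (splits 2 J) & (i < 7)%N])
  (subs 6 (iota 0 7)).
Proof. by vm_compute. Qed.

(** * Pointwise identities in an adapted frame *)

Section G2Frame.
Context {R : realType} (A E : 'M[R]_7) (AE : A *m E = 1%:M).
Context (p : kform R 7 3) (pA : p =1 pullback A (@phi0 R)) (ap : alternating p).
Local Notation V := 'rV[R]_7.
Local Notation e := (frame E).
Local Notation Phi := (list_form p).
Implicit Types (I J K : seq nat) (a b : seq V -> R) (u v : V).

Let aPhi : multilinear_alt Phi := list_form_alt ap.

Lemma lvol_iota : lvol A (map e (iota 0 7)) = 1.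
Proof.
have := top_form AE (lvol_alt A) (s := map e (iota 0 7)) (erefl _).
set x := lvol _ _ => xx; suff x0 : x != 0 by apply: (mulfI x0); rewrite mulr1 -xx.
rewrite /x /lvol /list_form size_map size_iota eqxx /pullback.
rewrite (_ : list_mx _ _ = E) ?(mulmx1C AE) ?det1 ?oner_neq0//.
apply/row_matrixP => i; rewrite rowK (nth_map 0%N) ?size_iota//.
by rewrite nth_iota// add0n /frame inord_val.
Qed.

Lemma lvol_index I : uniq I -> (sort_sign I).2 = iota 0 7 ->
  lvol A (map e I) = (vol_index I)%:~R.
Proof.
move=> uI sI; rewrite (alt_sort e I (lvol_alt A)) sI lvol_iota mulr1 /vol_index uI.
by rewrite rmorphXn rmorphN1.
Qed.

Lemma lstar_index k l b J : star_check k l -> J \in subs l (iota 0 7) ->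
  lstar A E k b (map e J) = (vol_index (compl7 J ++ J))%:~R * b (map e (compl7 J)).
Proof.
move=> /andP[/allP ch us] /ch /and4P[cJ uJ /eqP sJ /allP oth].
rewrite /lstar pairing_incr_subs (bigD1_seq _ cJ us) /= -map_cat lvol_index//.
rewrite big_seq_cond big1 ?addr0 1?mulrC// => s /andP[/oth].
case: eqP => //= _ nu _.
by rewrite -map_cat (alt_nuniq e (lvol_alt A) nu) mulr0.
Qed.

Lemma det3 (M : 'M[R]_3) (m : nat -> nat -> R) :
  (forall i j : 'I_3, M i j = m i j) ->
  \det M = m 0 0 * (m 1 1 * m 2 2 - m 1 2 * m 2 1)
  - m 0 1 * (m 1 0 * m 2 2 - m 1 2 * m 2 0)
  + m 0 2 * (m 1 0 * m 2 1 - m 1 1 * m 2 0).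
Proof.
move=> Mm; rewrite (expand_det_row _ ord0) !big_ord_recl big_ord0 /cofactor.
rewrite !(expand_det_row _ ord0) !big_ord_recl !big_ord0 /cofactor.
rewrite !det_mx11 !mxE !Mm /=; rewrite /bump /=; ring.
Qed.

Lemma frame_mulA i (c : 'I_7) : (i < 7)%N -> (e i *m A) 0 c = (i == c)%:R.
Proof.
move=> i7; rewrite /frame -row_mul (mulmx1C AE) !mxE.
by rewrite -val_eqE /= inordK.
Qed.

Lemma dx_frame i j k x y z : (i < 7)%N -> (j < 7)%N -> (k < 7)%N ->
  (x.-1 < 7)%N -> (y.-1 < 7)%N -> (z.-1 < 7)%N ->
  dx x y z (list_mx 3 (map e [:: i; j; k]) *m A) =
    (dx_index [:: x; y; z] [:: i; j; k])%:~R :> R.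
Proof.
move=> i7 j7 k7 x7 y7 z7; rewrite /dx.
rewrite (det3 (m := fun r s => (nth 0%N [:: i; j; k] r ==
    (nth 0%N [:: x; y; z] s).-1)%:R)).
  have mc (t : bool) : (t%:R : int)%:~R = t%:R :> R by case: t.
  by rewrite /dx_index !(rmorphD, rmorphN, rmorphM) /= !mc.
move=> r s; rewrite mxE.
have -> (M : 'M[R]_(3, 7)) c : (M *m A) r c = (row r M *m A) 0 c.
  by rewrite -row_mul [RHS]mxE.
rewrite rowK (nth_map 0%N)//=.
have lt7 q : (q < 3)%N -> (nth 0%N [:: i; j; k] q < 7)%N by case: q => [|[|[|]]].
have lx7 q : (q < 3)%N -> ((nth 0%N [:: x; y; z] q).-1 < 7)%N by case: q => [|[|[|]]].
by rewrite frame_mulA ?lt7 ?inordK ?lx7.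
Qed.

Lemma phi_frame I : size I = 3%N -> all (gtn 7) I ->
  Phi (map e I) = (phi_index I)%:~R.
Proof.
case: I => [|i [|j [|k []]]]// _ /and4P[i7 j7 k7 _].
rewrite /list_form /= pA /pullback /phi0 !dx_frame//.
by rewrite /phi_index !(rmorphD, rmorphN).
Qed.

Definition Psi := lstar A E 3 Phi.

Lemma Psi_alt : multilinear_alt Psi. Proof. exact: lstar_alt. Qed.

Lemma psi_frame J : J \in subs 4 (iota 0 7) -> Psi (map e J) = (psi_index J)%:~R.
Proof.
move=> sJ; rewrite /Psi (lstar_index _ star_check34 sJ).
have /andP[/eqP s3 a7] := allP compl_check4 J sJ.
by rewrite phi_frame// /psi_index rmorphM.
Qed.

Lemma lwedge_contract_psi v (s : seq V) : size s = 6%N ->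
  lwedge 2 (contract v Phi) Psi s = 3 * lvol A (v :: s).
Proof.
have aL := altZf 3 (contract_alt v (lvol_alt A)).
apply: (alt_eq_subs (lwedge_alt 2 (contract_alt v aPhi) Psi_alt) aL (frame_span AE)).
move=> J sJ; rewrite -[RHS]/(3 * lvol A (v :: map e J)).
move: v {aL}; apply: linear_eq_basis (frame_span AE) _.
- by move=> c u w; rewrite (contract_linear c u w aPhi) lwedgeDl lwedgeZl.
- by move=> c u w; rewrite (alt_linear c u w _ (lvol_alt A)); ring.
move=> i i7; have iI : i \in iota 0 7 by rewrite mem_iota.
have /and3P[/eqP ci /orP vi /allP qi] := allP (allP contract_psi_check J sJ) i iI.
rewrite lwedge_map (lwedge_eq_splits (a' := fun t => (contract i phi_index t)%:~R)
  (b' := fun t => (psi_index t)%:~R)).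
- rewrite lwedge_int ci rmorphM -map_cons; congr (_ * _).
  case: vi => [nu|/andP[ui /eqP si]]; last by rewrite lvol_index.
  by rewrite (alt_nuniq e (lvol_alt A) nu) /vol_index (negbTE nu).
- move=> q /qi /and3P[/eqP sq aq _].
  by rewrite -[LHS]/(Phi (map e (i :: q.2.1))) phi_frame//= ?sq// i7.
- by move=> q /qi /and3P[_ _ sq]; rewrite /= psi_frame.
Qed.

(** The forms v _| phi make up Lambda^2_7, on which beta |-> *(phi /\ beta) is multiplication by
    2. *)
Lemma lwedge_phi_contract v (s : seq V) : size s = 5%N ->
  lwedge 3 Phi (contract v Phi) s = 2 * lstar A E 2 (contract v Phi) s.
Proof.
have aL := altZf 2 (lstar_alt A E 2 (contract v Phi)).
apply: (alt_eq_subs (lwedge_alt 3 aPhi (contract_alt v aPhi)) aL (frame_span AE)).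
move=> J sJ; rewrite -[RHS]/(2 * lstar A E 2 (contract v Phi) (map e J)).
rewrite (lstar_index _ star_check25 sJ).
move: v {aL}; apply: linear_eq_basis (frame_span AE) _.
- by move=> c u w; rewrite (contract_linear c u w aPhi) lwedgeDr lwedgeZr.
- by move=> c u w; rewrite (contract_linear c u w aPhi) /=; ring.
move=> i i7; have iI : i \in iota 0 7 by rewrite mem_iota.
have /and4P[/eqP ci cJ aJ /allP qi] := allP (allP phi_contract_check J sJ) i iI.
rewrite lwedge_map (lwedge_eq_splits (a' := fun t => (phi_index t)%:~R)
  (b' := fun t => (contract i phi_index t)%:~R)).
- rewrite lwedge_int ci !rmorphM; congr (_ * (_ * _)).
  by rewrite -[RHS]/(Phi (map e (i :: compl7 J))) phi_frame//= ?(eqP cJ)// i7.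
- by move=> q /qi /and4P[/eqP sq aq _ _]; rewrite /= phi_frame.
- move=> q /qi /and4P[_ _ /eqP sq aq].
  by rewrite -[LHS]/(Phi (map e (i :: q.2.2))) phi_frame//= ?sq// i7.
Qed.

Lemma lwedge_lstar a b :
  lwedge 2 a (lstar A E 2 b) (map e (iota 0 7)) =
    pairing_incr 2 (iota 0 7) (a \o map e) (b \o map e).
Proof.
rewrite lwedge_map lwedge_splits pairing_incr_subs.
have [/eqP <- /allP ch] := andP splits_check.
rewrite big_map; apply: eq_big_seq => q /ch /and3P[sq /eqP cq /eqP vq] /=.
rewrite (lstar_index _ star_check25 sq) cq mulrCA; congr (_ * _).
by rewrite mulrA -intrM vq mul1r.
Qed.

Lemma pairing_contract_phi u v :
  pairing_incr 2 (iota 0 7) (contract u Phi \o map e) (contract v Phi \o map e) =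
    3 * (u *m A *m (v *m A)^T) 0 0.
Proof.
move: u; apply: linear_eq_basis (frame_span AE) _.
- move=> c u w; rewrite (contract_linear c u w aPhi) !pairing_incr_subs.
  rewrite big_distrr -big_split; apply: eq_bigr => q _ /=; ring.
- by move=> c u w; rewrite !mulmxDl -!scalemxAl !mxE; ring.
move=> i i7; move: v; apply: linear_eq_basis (frame_span AE) _.
- move=> c u w; rewrite (contract_linear c u w aPhi) !pairing_incr_subs.
  rewrite big_distrr -big_split; apply: eq_bigr => q _ /=; ring.
- move=> c u w; rewrite mulmxDl -scalemxAl linearD linearZ mulmxDr -scalemxAr.
  by rewrite !mxE; ring.
move=> j j7; have iI : i \in iota 0 7 by rewrite mem_iota.
have jI : j \in iota 0 7 by rewrite mem_iota.
set P := pairing_incr _ _ _ _.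
rewrite mxE (bigD1 (inord i))//= big1 ?addr0; last first.
  move=> k ki; rewrite frame_mulA// (_ : (i == k) = false) ?mul0r//.
  apply/eqP => ik; move/eqP: ki; apply; apply: val_inj.
  by rewrite /= inordK// -ik.
rewrite [_^T _ _]mxE !frame_mulA// inordK// eqxx mul1r.
have /eqP c3 := allP (allP pairing_check i iI) j jI.
have -> : (3 : R) * (j == i)%:R = (3 * (j == i)%:R : int)%:~R.
  by rewrite rmorphM /= !rmorph_nat.
have foldE L : (foldr (fun s z => phi_index (i :: s) * phi_index (j :: s) + z) 0 L)%:~R
    = \sum_(s <- L) (phi_index (i :: s))%:~R * (phi_index (j :: s))%:~R :> R.
  by elim: L => [|s L IH] /=; rewrite ?big_nil// big_cons -IH rmorphD rmorphM.
rewrite -c3 foldE /P pairing_incr_subs; apply: eq_big_seq => s sS.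
have /andP[/eqP s2 s7] := allP subs2_check s sS.
rewrite -[X in X * _]/(Phi (map e (i :: s))).
rewrite -[X in _ * X]/(Phi (map e (j :: s))).
by rewrite !phi_frame//= ?s2 ?i7 ?j7.
Qed.

(** The 6 is 2 times 3: phi /\ (v _| phi) is twice the star of v _| phi, and <u _| phi, v _| phi> =
    3 g(u, v). *)
Lemma lwedge_contract_phi_phi u v :
  lwedge 2 (contract u Phi) (lwedge 3 Phi (contract v Phi)) (map e (iota 0 7)) =
    6 * (u *m A *m (v *m A)^T) 0 0.
Proof.
rewrite (lwedge_eq_size (a' := contract u Phi)
  (b' := 2 \*o lstar A E 2 (contract v Phi)))//.
  by rewrite lwedgeZr lwedge_lstar pairing_contract_phi; ring.
move=> t st; apply: lwedge_phi_contract; apply/eqP.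
by rewrite -(eqn_add2r 2) st.
Qed.

Lemma lwedge_phi_psi : lwedge 3 Phi Psi (map e (iota 0 7)) = 7.
Proof.
have /andP[/eqP c7 /allP ch] := phi_psi_check.
rewrite lwedge_map (lwedge_eq_splits (a' := fun t => (phi_index t)%:~R)
  (b' := fun t => (psi_index t)%:~R)).
- by rewrite lwedge_int c7.
- by move=> q /ch /and3P[/eqP sq aq _]; rewrite /= phi_frame.
- by move=> q /ch /and3P[_ _ sq]; rewrite /= psi_frame.
Qed.

Lemma lstarK T (s : seq V) : multilinear_alt T -> size s = 2%N ->
  lstar A E 5 (lstar A E 2 T) s = T s.
Proof.
move=> aT; apply: (alt_eq_subs (lstar_alt _ _ _ _) aT (frame_span AE)) => J sJ.
rewrite (lstar_index _ star_check52 sJ).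
have /and3P[sc /eqP cc /eqP vv] := allP compl_check2 J sJ.
by rewrite (lstar_index _ star_check25 sc) cc mulrA -intrM vv mul1r.
Qed.

Section Lambda14.
Variable (T : seq V -> R).
Hypothesis (aT : multilinear_alt T).
Hypothesis (T14 : forall s : seq V, size s = 5%N ->
  lwedge 2 T Phi s = - lstar A E 2 T s).

Lemma tau_relation0 K : K \in subs 5 (iota 0 7) ->
  lin_eval (T \o map e) (tau_relation K) = 0.
Proof.
move=> sK; have /andP[/eqP s5 /allP qK] := allP tau_check K sK.
rewrite /tau_relation -cat1s lin_eval_cat -lwedge_lin.
rewrite -(lwedge_eq_splits (a := T \o map e) (b := Phi \o map e))//.
  rewrite -lwedge_map T14 ?size_map// (lstar_index _ star_check25 sK).
  by rewrite /lin_eval big_seq1 subrr.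
by move=> q /qK /andP[/eqP sq aq]; rewrite /= phi_frame.
Qed.

Lemma phi_row0 i : (i < 7)%N -> lin_eval (T \o map e) (phi_row i) = 0.
Proof.
move=> i7; have iI : i \in iota 0 7 by rewrite mem_iota.
(* The weights are the components of the star of e_i _| phi. As beta |-> *(phi /\ beta) is
   self-adjoint with eigenvalue 2 at e_i _| phi, the weighted sum of the relations is (2 + 1) <e_i
   _| phi, tau>. *)
pose w K := vol_index (compl7 K ++ K) * phi_index (i :: compl7 K).
pose l := flatten [seq [seq (w K * q.1, q.2) | q <- tau_relation K]
                 | K <- subs 5 (iota 0 7)].
have l0 : lin_eval (T \o map e) l = 0.
  rewrite /l; have := @tau_relation0; elim: (subs 5 _) => [|K L IH] h.
    by rewrite /lin_eval big_nil.
  rewrite map_cons -[flatten _]/(_ ++ flatten _).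
  rewrite lin_eval_cat lin_evalZ h ?mem_head// mulr0 add0r IH// => K' K'L.
  by rewrite h// in_cons K'L orbT.
have /and3P[ch1 ch2 ch3] := allP phi_row_check i iI.
have := lin_eval_eq (T \o map e) subs2_uniq ch1 ch2 ch3.
rewrite -/l -/w -/l l0 lin_evalZ => /esym/eqP.
by rewrite mulf_eq0 => /orP[|/eqP//]; rewrite intr_eq0.
Qed.

Lemma lwedge_tau_psi (s : seq V) : size s = 6%N -> lwedge 2 T Psi s = 0.
Proof.
apply: (alt_eq0_basis (lwedge_alt 2 aT Psi_alt) (frame_span AE)) => m sm cm.
have sJ : mask m (iota 0 7) \in subs 6 (iota 0 7).
  by have := mem_subs_mask (sm : size m = size (iota 0 7)); rewrite cm.
move: (mask _ _) sJ => J sJ.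
have /and5P[c1 c2 c3 /allP c4 i7] := allP tau_psi_check J sJ.
rewrite lwedge_map (lwedge_eq_splits (a' := T \o map e)
  (b' := fun t => (psi_index t)%:~R))//.
  rewrite lwedge_lin (lin_eval_eq _ subs2_uniq c1 c2 c3) lin_evalZ phi_row0 ?mulr0//.
by move=> q /c4 sq; rewrite /= psi_frame.
Qed.

Lemma pairing_tau v :
  pairing_incr 2 (iota 0 7) (contract v Phi \o map e) (T \o map e) = 0.
Proof.
move: v; apply: (linear_eq_basis (g := fun=> 0)) (frame_span AE) _.
- move=> c u w; rewrite (contract_linear c u w aPhi) !pairing_incr_subs.
  rewrite big_distrr -big_split; apply: eq_bigr => q _ /=; ring.
- by move=> c u w; ring.
move=> i i7; rewrite -(phi_row0 i7) pairing_incr_subs /lin_eval big_map.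
apply: eq_big_seq => s sS /=; have /andP[/eqP s2 s7] := allP subs2_check s sS.
by rewrite -[X in X * _]/(Phi (map e (i :: s))) phi_frame//= ?s2 ?i7.
Qed.

End Lambda14.

End G2Frame.

(** A permutation is given by the image [j] of 0, which contributes the sign (-1)^j, and a
    permutation of the other points, relabelled by [bump j] to avoid [j]. This makes the sum over
    permutations in [wedge] computable. *)
Fixpoint signed_perms (n : nat) : seq (int * seq nat) :=
  if n is n'.+1 then
    flatten [seq [seq ((-1) ^+ j * q.1, j :: map (bump j) q.2) | q <- signed_perms n']
            | j <- iota 0 n]
  else [:: (1, [::])].

Lemma sum_signed_perms (R : comNzRingType) n (G : seq nat -> R) :
  \sum_(s : 'S_n) (-1) ^+ s * G [seq val (s i) | i <- enum 'I_n] =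
  \sum_(q <- signed_perms n) q.1%:~R * G q.2.
Proof.
elim: n G => [|n IH] G.
  have e0 : enum 'I_0 = [::] by apply: size0nil; rewrite size_enum_ord.
  rewrite big_seq1 e0 (big_pred1 1%g) => [|s]; first by rewrite odd_perm1.
  by apply/esym/eqP/permP => -[].
pose h (x : 'I_n.+1 * 'S_n) : 'S_n.+1 := lift_perm ord0 x.1 x.2.
have hinj : injective h.
  move=> [i s] [j t] /permP /= hh.
  have ij : i = j by have := hh ord0; rewrite !lift_perm_id.
  subst j; congr (_, _); apply/permP => k.
  by have := hh (lift ord0 k); rewrite !lift_perm_lift => /lift_inj.
have hb : bijective h.
  by apply: inj_card_bij hinj _; rewrite card_prod !card_Sn card_ord factS.
rewrite (reindex h); last exact: onW_bij.
rewrite -[signed_perms n.+1]/(flatten _) big_flatten big_map.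
rewrite (sum_iota n.+1 (fun j => \sum_(q <- [seq ((-1) ^+ j * q.1,
   j :: map (bump j) q.2) | q <- signed_perms n]) q.1%:~R * G q.2)).
rewrite -(pair_bigA _ (fun i s => (-1) ^+ h (i, s) *
  G [seq val (h (i, s) r) | r <- enum 'I_n.+1])).
apply: eq_bigr => i _; rewrite big_map /=.
rewrite (eq_bigr (fun q : int * seq nat => (-1) ^+ i *
  (q.1%:~R * G (nat_of_ord i :: map (bump i) q.2)))); last first.
  by move=> q _; rewrite rmorphM rmorphXn rmorphN1 mulrA.
rewrite -big_distrr -(IH (fun L => G (nat_of_ord i :: map (bump i) L))) big_distrr.
apply: eq_bigr => s _ /=; rewrite mulrA; congr (_ * G _).
  by rewrite odd_lift_perm /= signr_addb signr_odd.
rewrite enum_ordSl /= lift_perm_id; congr (_ :: _).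
by rewrite -!map_comp; apply: eq_map => r /=; rewrite lift_perm_lift.
Qed.

(* The terms of Defs.wedge, with the arguments of both factors sorted. *)
Definition wedge_terms (k n : nat) : seq (int * seq nat) :=
  [seq ((q.1 * (-1) ^+ (sort_sign (take k q.2)).1) * (-1) ^+ (sort_sign (drop k q.2)).1,
        (sort_sign (take k q.2)).2 ++ (sort_sign (drop k q.2)).2)
  | q <- signed_perms n].

(** The constant is 12 = 2! 3!: after sorting within the two blocks, that many permutations yield
    the same shuffle with the same sign. It cancels the normalization of [wedge]. *)
Lemma wedge_check :
  let l := wedge_terms 2 5 in
  let l' := [seq (12 * q.1, q.2) |
              q <- [seq (q.1, q.2.1 ++ q.2.2) | q <- splits 2 (iota 0 5)]] in
  let S := [seq q.2 | q <- l'] in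
  [&& uniq S, all (fun q => q.2 \in S) l, all (fun q => q.2 \in S) l',
    all (fun p => coef l p == coef l' p) S,
    all (fun q => size (sort_sign (take 2 q.2)).2 == 2) (signed_perms 5) &
    all (fun q => size q.2.1 == 2) (splits 2 (iota 0 5))].
Proof. by vm_compute. Qed.

Lemma wedge_list (R : realType) (n : nat) (a : kform R n 2) (b : kform R n 3)
    (s : seq 'rV[R]_n) : alternating a -> alternating b -> size s = 5%N ->
  wedge a b (list_mx 5 s) = lwedge 2 (list_form a) (list_form b) s.
Proof.
move=> aa ab s5; have aA := list_form_alt aa; have aB := list_form_alt ab.
pose e := nth 0 s.
have /and5P[uS lS lS' ch /andP[/allP c1 /allP c2]] := wedge_check.
pose H K := list_form a (map e (take 2 K)) * list_form b (map e (drop 2 K)).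
have perm_sum : \sum_(p : 'S_5) (-1) ^+ p *
     a (usubmx (row_perm p (list_mx 5 s) : 'M_(2 + 3, n))) *
     b (dsubmx (row_perm p (list_mx 5 s) : 'M_(2 + 3, n))) =
    lin_eval H (wedge_terms 2 5).
  rewrite /lin_eval big_map.
  rewrite (eq_bigr (fun p : 'S_5 => (-1) ^+ p * H [seq val (p i) | i <- enum 'I_5])).
    rewrite sum_signed_perms; apply: eq_big_seq => q /c1 /eqP sq /=.
    rewrite /H (alt_sort e _ aA) (alt_sort e _ aB) take_cat drop_cat sq ltnn subnn.
    rewrite take0 cats0 drop0 !rmorphM !rmorphXn !rmorphN1; ring.
  move=> p _; rewrite -mulrA; congr (_ * _); rewrite /H -map_take -map_drop.
  rewrite !enum_ordSl /= (size0nil (size_enum_ord 0)) /=.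
  congr (_ * _); rewrite /list_form /=; congr (_ _); apply/matrixP => i j; rewrite !mxE /e.
    case: i => -[|[|//]] i2; rewrite /=; congr (nth 0 s (p _) 0 j); exact: val_inj.
  case: i => -[|[|[|//]]] i2; rewrite /=; congr (nth 0 s (p _) 0 j); exact: val_inj.
rewrite /wedge perm_sum (lin_eval_eq H uS lS lS' ch) lin_evalZ.
have c12 : (2`!%:R * 3`!%:R)^-1 * (12 : int)%:~R = 1 :> R.
  have -> : (12 : int)%:~R = 2`!%:R * 3`!%:R :> R by rewrite -natrM rmorph_nat.
  by rewrite mulVf// -natrM pnatr_eq0.
rewrite mulrA c12 mul1r.
have -> : s = map e (iota 0 5) by rewrite -{1}(mkseq_nth 0 s) s5.
rewrite lwedge_map lwedge_splits /lin_eval big_map; apply: eq_big_seq => q /c2 /eqP sq.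
by rewrite /H /= take_cat drop_cat sq ltnn subnn take0 cats0 drop0.
Qed.

(** * Smoothness of psi *)

Section ClassCForms.
Context {R : realType} {n : nat}.
Local Notation V := 'rV[R]_n.
Implicit Types (U : set V) (m k : nat).

Lemma class_C_lwedge m U k (a b : V -> seq V -> R) s : open U ->
  (forall t, class_C m U (fun y => a y t)) ->
  (forall t, class_C m U (fun y => b y t)) ->
  class_C m U (fun y => lwedge k (a y) (b y) s).
Proof.
move=> oU; elim: s k a b => [|v s IH] [|k] a b ca cb /=.
- exact: class_CM.
- exact: class_C_cst.
- exact: class_CM.
apply: class_CD => //.
  by apply: (IH k (fun y => contract v (a y))) => // t; exact: ca.
apply: class_CM => //; first exact: class_C_cst.
by apply: (IH k.+1 a (fun y => contract v (b y))) => // t; exact: cb.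
Qed.

Lemma class_C_list_form m U k (w : V -> kform R n k) s :
  (forall W, class_C m U (fun y => w y W)) ->
  class_C m U (fun y => list_form (w y) s).
Proof.
move=> cw; rewrite /list_form; case: (size s == k); first exact: cw.
exact: class_C_cst.
Qed.

End ClassCForms.

Section PsiSmooth.
Context {R : realType}.
Local Notation V := 'rV[R]_7.
Context (U : set V) (oU : open U) (phi : V -> kform R 7 3).
Context (smooth_phi : forall m W, class_C m U (fun y => phi y W)).
Context (alt_phi : forall y, U y -> alternating (phi y)).
Context (pos_phi : forall y, U y -> positive (phi y)).
Implicit Types (m k : nat) (y : V).

Local Notation A y := (g2_frame (phi y)).
Local Notation E y := (invmx (g2_frame (phi y))).
Local Notation Phi y := (list_form (phi y)).
Local Notation delta y := (\det (g2_frame (phi y))).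

Lemma g2_frame_adapted y : U y -> adapted (phi y) (A y).
Proof. by move=> /pos_phi Py; exact: (@xgetPex _ 1%:M [set B | adapted (phi y) B]). Qed.

Lemma frameK y : U y -> A y *m E y = 1%:M.
Proof. by move=> /g2_frame_adapted[uA _]; rewrite mulmxV. Qed.

Lemma frame_pullback y : U y -> phi y =1 pullback (A y) (@phi0 R).
Proof. by move=> /g2_frame_adapted[]. Qed.

Lemma delta_neq0 y : U y -> delta y != 0.
Proof. by move=> /g2_frame_adapted[uA _]; rewrite -unitfE -unitmxE. Qed.

(* Bryant's formula (u _| phi) /\ phi /\ (v _| phi) = 6 g(u, v) vol, evaluated
   on the standard basis. *)
Definition bryant_form y : 'M[R]_7 := \matrix_(i, j)
  lwedge 2 (contract (frame 1%:M i) (Phi y))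
    (lwedge 3 (Phi y) (contract (frame 1%:M j) (Phi y)))
    (map (frame 1%:M) (iota 0 7)).

Lemma bryant_formE y : U y -> bryant_form y = (6 * delta y) *: g2_metric (phi y).
Proof.
move=> Uy; have AE := frameK Uy; have aP := list_form_alt (alt_phi Uy).
apply/matrixP => i j; rewrite mxE.
rewrite (top_form AE (lwedge_alt 2 (contract_alt _ aP)
  (lwedge_alt 3 aP (contract_alt _ aP)))) ?size_map//.
rewrite (lwedge_contract_phi_phi AE (frame_pullback Uy) (alt_phi Uy)).
have -> : lvol (A y) (map (frame 1%:M) (iota 0 7)) = delta y.
  rewrite /lvol /list_form size_map size_iota eqxx /pullback.
  rewrite (_ : list_mx _ _ = 1%:M) ?mul1mx//.
  apply/row_matrixP => r; rewrite rowK (nth_map 0%N) ?size_iota//.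
  by rewrite nth_iota// add0n /frame inord_val.
rewrite [RHS]mxE mulrAC; congr (_ * _ * _).
rewrite /g2_metric /frame !inord_val -!row_mul !mul1mx !mxE.
by apply: eq_bigr => c _; rewrite !mxE.
Qed.

Lemma class_C_bryant m i j : class_C m U (fun y => bryant_form y i j).
Proof.
have cP s : class_C m U (fun y => Phi y s) by exact: class_C_list_form.
apply: (class_C_ext oU (f := fun y => lwedge 2 (contract (frame 1%:M i) (Phi y))
    (lwedge 3 (Phi y) (contract (frame 1%:M j) (Phi y)))
    (map (frame 1%:M) (iota 0 7)))); first by move=> y _; rewrite mxE.
apply: class_C_lwedge => // t; first exact: cP.
by apply: class_C_lwedge => // t'; exact: cP.
Qed.

(** The exponent is 9 = 7 + 2: the scalar [6 * delta y] enters a determinant of size 7, and the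
    metric has determinant [delta y ^+ 2]. *)
Lemma det_bryant y : U y -> \det (bryant_form y) = 6 ^+ 7 * delta y ^+ 9.
Proof.
move=> Uy; rewrite bryant_formE// detZ /g2_metric det_mulmx det_tr.
by rewrite exprMn -mulrA -expr2 -exprD.
Qed.

Lemma class_C_delta9 m : class_C m U (fun y => delta y ^+ 9).
Proof.
apply: (class_C_ext oU (f := fun y => (6 ^+ 7)^-1 * \det (bryant_form y))).
  by move=> y Uy; rewrite det_bryant// mulKf// expf_neq0// pnatr_eq0.
apply: class_CM => //; first exact: class_C_cst.
by apply: class_C_det => // i j; exact: class_C_bryant.
Qed.

Lemma class_C_delta m : class_C m U (fun y => delta y).
Proof.
apply: (@class_C_root R 7 m 9 U _ oU) => //; first exact: delta_neq0.
  move=> y Uy; apply: differentiable_root9.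
  - exact: delta_neq0.
  - exact: (class_C_delta9 1).1.
  - near=> z; apply: delta_neq0; near: z; exact: open_nbhs_nbhs.
exact: class_C_delta9.
Unshelve. all: by end_near. Qed.

Lemma class_C_metric m i j : class_C m U (fun y => g2_metric (phi y) i j).
Proof.
have d0 y : U y -> 6 * delta y != 0.
  by move=> Uy; rewrite mulf_neq0 ?pnatr_eq0// delta_neq0.
have cd := class_CM oU (class_C_cst m U 6) (class_C_delta m).
apply: (class_C_ext oU _ (class_CM oU (class_CV oU d0 cd) (class_C_bryant m i j))).
by move=> y Uy; rewrite bryant_formE// mxE mulKf// d0.
Qed.

Lemma class_C_psi m W : class_C m U (fun y => star phi 4 phi y W).
Proof.
have ug y : U y -> g2_metric (phi y) \in unitmx.
  move=> /g2_frame_adapted[uA _].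
  by rewrite unitmx_mul unitmx_tr uA.
have cgV := class_C_invmx oU ug (class_C_metric m).
apply: class_CM => //; first exact: class_C_cst.
apply: class_C_sum => // I; apply: class_CM => //.
(* Besides the metric, the chosen frame enters only through its determinant, since the volume form
   is [delta] times the standard one. *)
apply: (class_C_ext oU (f := fun y =>
  \det (col_mx (rowsub I (invmx (g2_metric (phi y)))) W : 'M_(3 + 4)) * delta y)).
  move=> y Uy; rewrite /g2_vol /pullback.
  rewrite (conform_mx_id 0 (col_mx (rowsub I (invmx (g2_metric (phi y)))) W)).
  by rewrite det_mulmx.
apply: class_CM => //; last exact: class_C_delta.
apply: class_C_det => // i j; case: (split_ordP i) => r ->.
  apply: (class_C_ext oU _ (cgV (I r) j)) => y _.
  by rewrite [RHS]col_mxEu mxE.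
by apply: (class_C_ext oU _ (class_C_cst m U (W r j))) => y _; rewrite [RHS]col_mxEd.
Qed.

End PsiSmooth.

(** * Closed Laplacian solitons *)

Section ListStar.
Context {R : realType} {n' : nat}.
Local Notation n := n'.+1.
Local Notation V := 'rV[R]_n.
Implicit Types (A E : 'M[R]_n) (s t : seq V) (k : nat).

Lemma size_subs k (I J : seq nat) : J \in subs k I -> size J = k.
Proof.
elim: I k J => [|i I IH] [|k] J //=; try by rewrite inE => /eqP->.
by rewrite mem_cat => /orP[/mapP[K /IH <- ->]|/IH].
Qed.

Lemma lstar_eq A E k (b b' : seq V -> R) s :
  (forall t, size t = k -> b t = b' t) -> lstar A E k b s = lstar A E k b' s.
Proof.
move=> bb; rewrite /lstar !pairing_incr_subs; apply: eq_big_seq => J /size_subs sJ.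
by rewrite /= bb// size_map.
Qed.

Lemma lstarZ A E k (c : R) (b : seq V -> R) s :
  lstar A E k (c \*o b) s = c * lstar A E k b s.
Proof.
rewrite /lstar !pairing_incr_subs big_distrr; apply: eq_bigr => J _ /=.
by rewrite mulrA.
Qed.

Lemma list_mxK k s : size s = k -> mx_list (list_mx k s) = s.
Proof.
move=> sk; apply: (@eq_from_nth _ 0); rewrite size_mx_list// => i ik.
by rewrite -[i]/(val (Ordinal ik)) nth_mx_list rowK.
Qed.

Lemma list_form_size k (w : kform R n k) s : size s = k ->
  list_form w s = w (list_mx k s).
Proof. by move=> sk; rewrite /list_form sk eqxx. Qed.

(** An exterior derivative inherits alternation from an explicit formula for it; [star_list] can
    then be applied to it. *)
Lemma list_form_alt_eq k (w : kform R n k) (F : seq V -> R) :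
  multilinear_alt F -> (forall s, size s = k -> list_form w s = F s) ->
  multilinear_alt (list_form w).
Proof.
move=> aF wF; have wE s : list_form w s = if size s == k then F s else 0.
  by case: eqP => [/wF//|/eqP/negbTE sk]; rewrite /list_form sk.
split=> [s t c u v|s t u]; rewrite !wE !size_cat /=.
  by case: eqP => _; [exact: aF.1|rewrite mulr0 addr0].
by rewrite aF.2; case: eqP.
Qed.

Lemma ext_d_local k (w w' : V -> kform R n k) (U : set V) x W : open U -> U x ->
  (forall y W', U y -> w y W' = w' y W') -> ext_d w x W = ext_d w' x W.
Proof.
move=> oU Ux ww; rewrite /ext_d; apply: eq_bigr => i _; congr (_ * _).
apply: near_eq_derive; near=> y; apply: ww.
by near: y; exact: open_nbhs_nbhs.
Unshelve. all: by end_near. Qed.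

Lemma ext_d0 k x (W : 'M[R]_(k.+1, n)) : ext_d (fun (_ : V) _ => 0 : R) x W = 0.
Proof. by rewrite /ext_d big1// => i _; rewrite derive_cst mulr0. Qed.

End ListStar.

Section Soliton.
Context {R : realType}.
Local Notation V := 'rV[R]_7.
Context (U : set V) (oU : open U) (phi : V -> kform R 7 3).
Context (smooth_phi : forall m W, class_C m U (fun y => phi y W)).
Context (alt_phi : forall y, U y -> alternating (phi y)).
Context (pos_phi : forall y, U y -> positive (phi y)).
Implicit Types (k : nat) (x y : V) (s t : seq V).

Local Notation A y := (g2_frame (phi y)).
Local Notation E y := (invmx (g2_frame (phi y))).
Local Notation Phi := (fun y => list_form (phi y)).
Local Notation PsiF := (fun y => list_form (star phi 4 phi y)).

Let AE y (Uy : U y) : A y *m E y = 1%:M := frameK pos_phi Uy.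
Let aPhi y (Uy : U y) : multilinear_alt (list_form (phi y)) :=
  list_form_alt (alt_phi Uy).

Lemma star_list k l (w : V -> kform R 7 k) y s : U y -> (k + l = 7)%N ->
  multilinear_alt (list_form (w y)) -> size s = l ->
  list_form (star phi l w y) s = lstar (A y) (E y) k (list_form (w y)) s.
Proof.
move=> Uy kl aw sl; rewrite list_form_size// -{2}(list_mxK sl).
exact: hodge_star_frame (AE Uy) kl aw.
Qed.

Lemma star_zero k l (w : V -> kform R 7 k) y W :
  (forall W', w y W' = 0) -> star phi l w y W = 0.
Proof. by move=> w0; rewrite /star /g2_star /hodge_star big1 ?mulr0// => I _; rewrite w0 mul0r. Qed.

Lemma PsiE y s : U y -> size s = 4%N -> PsiF y s = Psi (A y) (E y) (phi y) s.
Proof. by move=> Uy s4; apply: star_list => //; exact: aPhi. Qed.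

Lemma smooth_PsiF m s : class_C m U (fun y => PsiF y s).
Proof. by apply: class_C_list_form => W; exact: class_C_psi. Qed.

Context (tau : V -> kform R 7 2) (X : V -> V) (lambda : R).
Local Notation T := (fun y => list_form (tau y)).
Context (closed_phi : forall y W, U y -> ext_d phi y W = 0).
Context (smooth_tau : forall m W, class_C m U (fun y => tau y W)).
Context (alt_tau : forall y, U y -> alternating (tau y)).
Context (torsion_wedge : forall y W, U y ->
  ext_d (star phi 4 phi) y W = wedge (tau y) (phi y) W).
Context (torsion_star : forall y W, U y ->
  ext_d (star phi 4 phi) y W = - star phi 5 tau y W).
Context (diff_X : forall y, U y -> differentiable X y).
Context (soliton : forall y W, U y ->
  laplacian phi phi y W = lambda * phi y W + lie X phi y W).

Let aT y (Uy : U y) : multilinear_alt (T y) := list_form_alt (alt_tau Uy).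

Lemma ld_psi_wedge y s : U y -> size s = 5%N ->
  ld PsiF y s = lwedge 2 (T y) (Phi y) s.
Proof.
move=> Uy s5; rewrite -ext_d_list// torsion_wedge//.
by apply: wedge_list => //; [exact: alt_tau|exact: alt_phi].
Qed.

Lemma ld_psi_star y s : U y -> size s = 5%N ->
  ld PsiF y s = - lstar (A y) (E y) 2 (T y) s.
Proof.
move=> Uy s5; rewrite -ext_d_list// torsion_star//; congr (- _).
by rewrite -list_form_size// star_list//; exact: aT.
Qed.

Lemma tau14 y : U y -> forall s, size s = 5%N ->
  lwedge 2 (T y) (Phi y) s = - lstar (A y) (E y) 2 (T y) s.
Proof. by move=> Uy s s5; rewrite -ld_psi_wedge// ld_psi_star. Qed.

(** In degree 3 the sign is -1, so d^* phi = - * d psi = * * tau, and the star is an involution on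
    2-forms. *)
Lemma codiff_phi y (W : 'M[R]_(2, 7)) : U y -> codiff phi phi y W = tau y W.
Proof.
move=> Uy; pose w := ext_d (star phi 4 phi).
have wE s : size s = 5%N ->
    list_form (w y) s = (-1 \*o lstar (A y) (E y) 2 (T y)) s.
  by move=> s5; rewrite list_form_size// /w ext_d_list// ld_psi_star//= mulN1r.
have aw := list_form_alt_eq (altZf (-1) (lstar_alt (A y) (E y) 2 (T y))) wE.
rewrite -[LHS]/((-1) ^+ 3 * star phi 2 w y W) -list_form_mx.
rewrite (star_list Uy _ aw) ?size_mx_list//.
rewrite (lstar_eq _ _ _ wE) lstarZ (lstarK (AE Uy) (aT Uy)) ?size_mx_list//.
by rewrite list_form_mx; ring.
Qed.

Lemma codiff_ext_d_phi x W : U x -> codiff phi (ext_d phi) x W = 0.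
Proof.
move=> Ux; rewrite /codiff star_zero ?mulr0// => W'.
rewrite (ext_d_local (w' := fun _ _ => 0) _ oU Ux); first exact: ext_d0.
by move=> y W'' Uy; apply: star_zero => W3; exact: closed_phi.
Qed.

Let diff_Phi y (Uy : U y) : diff_at Phi y.
Proof.
move=> s; have cP : class_C 1 U (fun z => Phi z s).
  exact: (class_C_list_form _ (smooth_phi 1)).
exact: cP.1.
Qed.

Let diff_T y (Uy : U y) : diff_at T y.
Proof.
move=> s; have cP : class_C 1 U (fun z => T z s).
  exact: (class_C_list_form _ (smooth_tau 1)).
exact: cP.1.
Qed.

Let diff_Psi y (Uy : U y) : diff_at PsiF y.
Proof. by move=> s; exact: (smooth_PsiF 1 s).1. Qed.

Let sigma y := contract (X y) (Phi y).

Let diff_sigma y (Uy : U y) : diff_at sigma y.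
Proof.
move=> s; exact: (differentiable_contract _ oU Uy aPhi (diff_Phi Uy) (diff_X Uy)).
Qed.

Lemma ld_phi x s : U x -> size s = 4%N -> ld Phi x s = 0.
Proof. by move=> Ux s4; rewrite -ext_d_list// closed_phi. Qed.

Lemma soliton_list x s : U x -> size s = 3%N ->
  ld T x s = lambda * Phi x s + ld sigma x s.
Proof.
move=> Ux s3; have := soliton (list_mx 3 s) Ux.
rewrite /laplacian codiff_ext_d_phi// addr0 (lie_list _ _ _ s3).
rewrite -(list_form_size (phi x) s3).
rewrite -(cartan_list _ oU Ux aPhi (diff_Phi Ux) (diff_X Ux)).
rewrite ld_phi//= ?s3// addr0 /sigma => <-.
rewrite -ext_d_list//; apply: (ext_d_local _ oU Ux) => y W Uy.
by rewrite codiff_phi.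
Qed.

Let omega y := sigma y \- T y.

Let diff_omega y (Uy : U y) : diff_at omega y.
Proof.
move=> s; apply: (@differentiableB R V R (fun z => sigma z s) (fun z => T z s)).
  exact: diff_sigma.
exact: diff_T.
Qed.

Lemma ld_omega x s : U x -> size s = 3%N -> ld omega x s = - lambda * Phi x s.
Proof.
move=> Ux s3; rewrite (ldB _ (diff_sigma Ux) (diff_T Ux)) soliton_list//.
ring.
Qed.

Lemma lwedge_oppr k (F G : seq V -> R) s :
  lwedge k F (-1 \*o G) s = - lwedge k F G s.
Proof. by rewrite lwedgeZr mulN1r. Qed.

Lemma lwedge_subl k (F F' G : seq V -> R) s :
  lwedge k (F \- F') G s = lwedge k F G s - lwedge k F' G s.
Proof.
rewrite -[- lwedge _ _ _ _]mulN1r -lwedgeZl -lwedgeDl; congr lwedge.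
by apply/funext => t /=; rewrite mulN1r.
Qed.

Lemma lwedge_subr k (F G G' : seq V -> R) s :
  lwedge k F (G \- G') s = lwedge k F G s - lwedge k F G' s.
Proof.
rewrite -[- lwedge _ _ _ _]mulN1r -lwedgeZr -lwedgeDr; congr lwedge.
by apply/funext => t /=; rewrite mulN1r.
Qed.

Lemma lwedge_comm32 (F G : seq V -> R) s : size s = 5%N ->
  lwedge 3 F G s = lwedge 2 G F s.
Proof.
case: s => [|v1 [|v2 [|v3 [|v4 [|v5 []]]]]] //= _.
by rewrite /contract; ring.
Qed.

(** Exchanging the two blocks of three arguments is an odd permutation, so the shuffles cancel in
    pairs. *)
Lemma lwedge_self3 (F : seq V -> R) s : size s = 6%N -> lwedge 3 F F s = 0.
Proof.
case: s => [|v1 [|v2 [|v3 [|v4 [|v5 [|v6 []]]]]]] //= _.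
by rewrite /contract; ring.
Qed.

Lemma codiff_contract_phi x (W : 'M[R]_(1, 7)) : U x ->
  codiff phi (fun y => int_prod (X y) (phi y)) x W = 0.
Proof.
move=> Ux; rewrite /codiff star_zero ?mulr0// => W'.
rewrite -[W']mx_listK ext_d_list ?size_mx_list//.
have := size_mx_list W'; move: (mx_list W') => s s6.
have sE y : list_form (int_prod (X y) (phi y)) = sigma y.
  by rewrite /sigma contract_list_form.
(* On lists of length 5 this is the star of sigma, with phi /\ tau rewritten as d psi. Its
   derivative then involves only d phi, d omega and d d psi. *)
pose F y := 2^-1 \*o (lwedge 3 (Phi y) (omega y) \+ ld PsiF y).
have c2 t : class_C 2 U (fun y => PsiF y t) by exact: smooth_PsiF.
have dPsi : diff_at (fun y => ld PsiF y) x.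
  by move=> t; exact: (class_C_ld oU c2 t).1.
have dPO := diff_at_lwedge 3 (diff_Phi Ux) (diff_omega Ux).
rewrite (ld_local (W' := F) oU Ux _ s6); last first.
  move=> y t Uy t5; rewrite star_list// sE; last exact/contract_alt/aPhi.
  have := lwedge_phi_contract (AE Uy) (frame_pullback pos_phi Uy) (alt_phi Uy) (X y) t5.
  rewrite /F /= lwedge_subr ld_psi_wedge// -lwedge_comm32// subrK -/(sigma y) => ->.
  by rewrite mulKf// pnatr_eq0.
rewrite ldZ; last first.
  by move=> t; apply: (@differentiableD R V R
    (fun y => lwedge 3 (Phi y) (omega y) t) (fun y => ld PsiF y t)).
rewrite ldD// (ld_ld _ oU Ux c2) addr0 (ld_lwedge _ _ (diff_Phi Ux) (diff_omega Ux)).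
rewrite (lwedge_eq_size (a' := fun=> 0) (b' := omega x))//; last first.
  by move=> t t4; exact: ld_phi.
rewrite lwedge0l add0r.
rewrite (lwedge_eq_size (a' := Phi x) (b' := - lambda \*o Phi x))//; last first.
  by move=> t t3; apply: ld_omega => //; apply/eqP; rewrite -(eqn_add2r 3) t3 s6.
by rewrite lwedgeZr lwedge_self3// !mulr0.
Qed.

Lemma flat_alt y : alternating (flat phi X y).
Proof.
split=> [W i c u v|W i j]; last by rewrite (ord1 i) (ord1 j) eqxx.
have E z : set_row W i z = z.
  by apply/matrixP => a b; rewrite !mxE (ord1 a) (ord1 i) eqxx.
by rewrite /flat !E linearD linearZ mulmxDr -scalemxAr !mxE.
Qed.

(** Both sides are X _| vol: the left one by expanding [X y] in the orthonormal frame, the right one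
    because sigma /\ psi is 3 times it and tau /\ psi = 0. *)
Lemma star_flat y t : U y -> size t = 6%N ->
  list_form (star phi 6 (flat phi X) y) t = 3^-1 * lwedge 2 (omega y) (PsiF y) t.
Proof.
move=> Uy t6; rewrite star_list//; last exact/list_form_alt/flat_alt.
have -> : lwedge 2 (omega y) (PsiF y) t =
    lwedge 2 (omega y) (Psi (A y) (E y) (phi y)) t.
  apply: lwedge_eq_size => // t' t4; apply: PsiE => //.
  by apply/eqP; rewrite -(eqn_add2r 2) t4 t6.
have fp := frame_pullback pos_phi Uy.
rewrite lwedge_subl (lwedge_tau_psi (AE Uy) fp (aT Uy) (tau14 Uy))//.
rewrite subr0 (lwedge_contract_psi (AE Uy) fp (alt_phi Uy) (X y) t6).
rewrite mulKf ?pnatr_eq0//.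
have XE : X y = \sum_(i < 7) (X y *m A y) 0 i *: frame (E y) i.
  rewrite -[LHS]mulmx1 -(AE Uy) mulmxA mulmx_sum_row; apply: eq_bigr => i _.
  by rewrite /frame inord_val.
rewrite XE (alt_sum [::] _ _ _ _ (lvol_alt _)) /lstar pairing_incr_subs.
rewrite (_ : subs 1 (iota 0 7) = [seq [:: i] | i <- iota 0 7])// big_map.
rewrite (sum_iota 7 (fun i => (list_form (flat phi X y) \o map (frame (E y))) [:: i] *
  lvol (A y) (map (frame (E y)) [:: i] ++ t))).
apply: eq_bigr => i _; rewrite (altZ [::] _ _ _ (lvol_alt _)); congr (_ * _).
rewrite /= list_form_size// /flat.
have -> : list_mx 1 [:: frame (E y) i] = frame (E y) i.
  by apply/row_matrixP => a; rewrite rowK (ord1 a) row_id.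
rewrite /g2_metric mulmxA -mulmxA -trmx_mul mxE (bigD1 i)//= big1 ?addr0.
  by rewrite [_^T _ _]mxE (frame_mulA (AE Uy))// eqxx mulr1.
move=> j ji; rewrite [_^T _ _]mxE (frame_mulA (AE Uy))// eq_sym.
by rewrite (_ : (nat_of_ord j == i) = false) ?mulr0//; exact: negbTE.
Qed.

Lemma trace_identity x (W : 'M[R]_(0, 7)) : U x ->
  3^-1 * normsq phi tau x + codiff phi (flat phi X) x W = 7 / 3 * lambda.
Proof.
move=> Ux; pose w := ext_d (star phi 6 (flat phi X)).
have fp := frame_pullback pos_phi Ux.
(* This is the derivative of [star_flat] by the Leibniz rule. As omega has even degree, omega /\ d
   psi enters with a plus sign, and d psi is minus the star of tau. *)
pose F := 3^-1 \*o (- lambda \*o lwedge 3 (Phi x) (Psi (A x) (E x) (phi x)) \+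
  lwedge 2 (omega x) (-1 \*o lstar (A x) (E x) 2 (T x))).
have wE s : size s = 7%N -> list_form (w x) s = F s.
  move=> s7; rewrite list_form_size// /w ext_d_list//.
  rewrite (ld_local (W' := fun y => 3^-1 \*o lwedge 2 (omega y) (PsiF y)) oU Ux _ s7);
    last by move=> y t Uy t6; rewrite star_flat.
  rewrite ldZ; last exact: diff_at_lwedge (diff_omega Ux) (diff_Psi Ux).
  rewrite ld_lwedge; [|exact: diff_omega|exact: diff_Psi].
  rewrite /F /=; congr (_ * (_ + _)).
    rewrite -lwedgeZl; apply: lwedge_eq_size => t tk; first exact: ld_omega.
    by apply: PsiE => //; apply/eqP; rewrite -(eqn_add2r 3) tk s7.
  rewrite expr2 mulrNN mulr1 mul1r; apply: lwedge_eq_size => // t tk.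
  rewrite ld_psi_star//= ?mulN1r//.
  by apply/eqP; rewrite -(eqn_add2r 2) tk s7.
have aOm : multilinear_alt (omega x).
  by apply: altB (aT Ux); apply: contract_alt; exact: aPhi.
have aF : multilinear_alt F.
  apply: altZf; split=> [s t c u v|s t u] /=.
    rewrite (lwedge_alt 3 (aPhi Ux) (Psi_alt _ _ _)).1.
    rewrite (lwedge_alt 2 aOm (altZf (-1) (lstar_alt _ _ _ _))).1; ring.
  rewrite (lwedge_alt 3 (aPhi Ux) (Psi_alt _ _ _)).2.
  by rewrite (lwedge_alt 2 aOm (altZf (-1) (lstar_alt _ _ _ _))).2; ring.
have aw := list_form_alt_eq aF wE.
rewrite -[codiff _ _ _ _]/((-1) ^+ 1 * star phi 0 w x W).
rewrite -(list_form_mx (star phi 0 w x)).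
rewrite (star_list Ux _ aw) ?size_mx_list//.
have -> : mx_list W = [::] by apply: size0nil; rewrite size_mx_list.
(* The star of a 7-form is its value on the oriented orthonormal frame. *)
have -> : lstar (A x) (E x) 7 (list_form (w x)) [::] =
    F (map (frame (E x)) (iota 0 7)).
  rewrite /lstar pairing_incr_subs (_ : subs 7 (iota 0 7) = [:: iota 0 7])// big_seq1.
  rewrite -[LHS]/(list_form (w x) (map (frame (E x)) (iota 0 7)) *
    lvol (A x) (map (frame (E x)) (iota 0 7) ++ [::])).
  by rewrite cats0 (lvol_iota (AE Ux)) mulr1 wE ?size_map.
rewrite -[F _]/(3^-1 * (- lambda * lwedge 3 (Phi x) (Psi (A x) (E x) (phi x))
  (map (frame (E x)) (iota 0 7)) + lwedge 2 (omega x)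
  (-1 \*o lstar (A x) (E x) 2 (T x)) (map (frame (E x)) (iota 0 7)))).
rewrite (lwedge_phi_psi (AE Ux) fp) lwedge_oppr lwedge_subl.
(* Since <sigma, tau> = 0, the pairing <omega, tau> is -|tau|^2. Hence [F] has the value (|tau|^2 -
   7 lambda) / 3, and d^* on 1-forms reverses the sign. *)
rewrite !(lwedge_lstar (AE Ux)) (pairing_tau (AE Ux) fp (alt_phi Ux) (tau14 Ux)).
rewrite /normsq (form_inner_frame (AE Ux) (aT Ux) (aT Ux)).
by move: (pairing_incr _ _ _ _) => N; field.
Qed.

End Soliton.

Theorem theorem4p2 (R : realType) (M : manifold R 7)
    (phi : form_field M 3) (X : vec_field M) (lambda : R)
    (tau : form_field M 2)
    (hsol : closed_Laplacian_soliton phi X lambda)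
    (hlambda : lambda != 0)
    (htau : torsion_form phi tau) :
  (forall (a : chart M) (x : 'rV[R]_7), chart_img a x -> forall V : 'M[R]_(0, 7),
     3^-1 * normsq (phi a) (tau a) x
       + codiff (phi a) (flat (phi a) (X a)) x V = 7 / 3 * lambda)
  /\
  (forall (a : chart M) (x : 'rV[R]_7), chart_img a x -> forall V : 'M[R]_(1, 7),
     codiff (phi a) (fun y => int_prod (X a y) (phi a y)) x V = 0).
Proof.
(* Both identities are local, so each chart is treated separately on its open image. *)
case: hsol => -[[[alt_phi smooth_phi _] pos_phi] closed_phi] [smooth_X _] soliton.
case: htau => -[alt_tau smooth_tau _] _ torsion_wedge torsion_star.
have sp a m W : class_C m (chart_img a) (fun y => phi a y W) by exact: smooth_phi.
have st a m W : class_C m (chart_img a) (fun y => tau a y W) by exact: smooth_tau.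
have dX a y : chart_img a y -> differentiable (X a) y by exact: (smooth_X a 1).1.
split=> a x ax V.
  apply: (trace_identity (@chart_img_open _ _ M a) (sp a) (alt_phi a) (pos_phi a)
    (tau := tau a) (X := X a) (lambda := lambda)) => //.
  - by move=> y W Uy; exact: closed_phi.
  - exact: alt_tau.
  - by move=> y W Uy; exact: torsion_wedge.
  - by move=> y W Uy; exact: torsion_star.
  - exact: dX.
  - by move=> y W Uy; exact: soliton.
apply: (codiff_contract_phi (@chart_img_open _ _ M a) (sp a) (alt_phi a) (pos_phi a)
  (tau := tau a) (lambda := lambda)) => //.
- by move=> y W Uy; exact: closed_phi.
- exact: alt_tau.
- by move=> y W Uy; exact: torsion_wedge.
- by move=> y W Uy; exact: torsion_star.
- exact: dX.
- by move=> y W Uy; exact: soliton.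
Qed.
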